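(* There is a polynomial-time algorithm which, given an instance $(p_{X_0},p_Z,K)$ of the discrete Witsenhausen problem, returns maps $T:\mathbb{Z}\to\mathbb{Z}$, $\delta:\mathbb{Z}\to\mathbb{Z}$ satisfying $$\Phi(p_{X_0},p_Z,T,\delta)\le |\mathcal{X}|^3\,|\mathcal{Z}|^4\,\Phi^*(p_{X_0},p_Z).$$
   Context: Discrete Witsenhausen problem: Let $X_0, Z$ be independent bounded random variables taking integer values, with probability mass functions $p_{X_0},p_Z$, and let $K>0$ be a constant. For maps $T:\mathbb{Z}\to\mathbb{Z}$ and $\delta:\mathbb{Z}\to\mathbb{Z}$ the Witsenhausen cost is $$\Phi(p_{X_0},p_Z,T,\delta)=E\left[(T(X_0)-X_0)^2+K\,\big(T(X_0)+\delta(T(X_0)+Z)\big)^2\right].$$ The dependence on $K$ is suppressed in the notation. The problem asks for maps $T,\delta:\mathbb{Z}\to\mathbb{Z}$ minimizing this cost, and $\Phi^*(p_{X_0},p_Z)$ denotes the minimum cost (which is attained). $\mathcal{X}$ denotes the support of $X_0$ and $\mathcal{Z}$ the support of $Z$. An instance is given by listing the support points (integers) of $p_{X_0}$ and $p_Z$ with their (rational) probabilities, together with the rational number $K$, all in the standard binary encoding; polynomial time is with respect to the length of this description. Returning $T$ and $\delta$ means returning the values of $T$ on $\mathcal{X}$ and of $\delta$ on $\{T(x)+z : x\in\mathcal{X}, z\in\mathcal{Z}\}$; other values do not affect the cost and may be set arbitrarily. *)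

(* Defs.v *)
From mathcomp Require Import all_boot all_order all_algebra.
From mathcomp Require Import finmap.
From mathcomp Require Import boolp classical_sets.

Set Implicit Arguments.
Unset Strict Implicit.
Unset Printing Implicit Defensive.

Import Order.TTheory GRing.Theory Num.Theory.

Local Open Scope fset_scope.
Local Open Scope ring_scope.

(* Finite support = bounded integer-valued random variable. [finsupp p] is the
   support {x | p x != 0}. *)
Notation massfun := {fsfun int -> rat with 0}.

Definition is_pmf (p : massfun) : Prop :=
  (forall x, 0 <= p x) /\ \sum_(x <- finsupp p) p x = 1.

(* E[f(X, Z)] for independent X ~ p and Z ~ q. *)
Definition expect_indep (p q : massfun) (f : int -> int -> rat) : rat :=
  \sum_(x <- finsupp p) \sum_(z <- finsupp q) p x * q z * f x z.

Definition Phi (K : rat) (pX pZ : massfun) (T delta : int -> int) : rat :=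
  expect_indep pX pZ (fun x z =>
    (T x - x)%:~R ^+ 2 + K * (T x + delta (T x + z))%:~R ^+ 2).

Definition is_min_cost (K : rat) (pX pZ : massfun) (v : rat) : Prop :=
  (exists T delta, Phi K pX pZ T delta = v) /\
  (forall T delta, v <= Phi K pX pZ T delta).

(* The default value 0 is never used on an instance: see [Phi_starP]. *)
Definition Phi_star (K : rat) (pX pZ : massfun) : rat :=
  xget 0 [set v | is_min_cost K pX pZ v]%classic.

Record instance := Instance { pX0 : massfun; pZ : massfun; Kcost : rat }.

Definition valid (I : instance) : Prop :=
  [/\ is_pmf (pX0 I), is_pmf (pZ I) & 0 < Kcost I].

Definition enc_rat (r : rat) : seq int := [:: numq r; denq r].

Definition enc_pmf (p : massfun) (s : seq int) : seq int :=
  Posz (size s) :: flatten [seq x :: enc_rat (p x) | x <- s].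

(* The support points may be listed in any order. *)
Definition describes (w : seq int) (I : instance) : Prop :=
  exists sX sZ : seq int,
    [/\ perm_eq sX (finsupp (pX0 I)), perm_eq sZ (finsupp (pZ I))
      & w = enc_pmf (pX0 I) sX ++ enc_pmf (pZ I) sZ ++ enc_rat (Kcost I)].

Definition enc_table (t : seq (int * int)) : seq int :=
  Posz (size t) :: flatten [seq [:: e.1; e.2] | e <- t].

Definition tabulates (t : seq (int * int)) (f : int -> int) (S : {fset int}) :=
  perm_eq (unzip1 t) S /\ (forall e, e \in t -> f e.1 = e.2).

Definition returns (o : seq int) (I : instance) (T delta : int -> int) : Prop :=
  exists tT tdelta : seq (int * int),
    [/\ tabulates tT T (finsupp (pX0 I)),
        tabulates tdelta delta
          [fset T x + z | x in finsupp (pX0 I), z in finsupp (pZ I)]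
      & o = enc_table tT ++ enc_table tdelta].

(* The model of Aho, Hopcroft and Ullman (The Design and Analysis of Computer
   Algorithms, 1974, ch. 1) in three-address form, with a sequential input tape
   and a sequential output tape of integers. Registers are indexed by all of Z,
   so that indirect addressing is total. Every operand is charged the binary
   length of each integer it involves, register addresses included; this makes
   polynomial time the same as for Turing machines. *)

(* Number of binary digits of |a|: floor(log2 |a|) + 1, and 1 if a = 0. *)
Definition bitlen (a : int) : nat := (trunc_log 2 `|a|%N).+1.

Definition bitsize (w : seq int) : nat := (\sum_(a <- w) bitlen a)%N.

Inductive location := Direct of int | Indirect of int.

Inductive operand := Lit of int | Content of location.

Inductive arith := Add | Sub | Mul | Div.

Inductive instr :=
| Arith of arith & location & operand & operand
| Read of location
| Write of operand
| Jump of nat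
| JumpPos of operand & nat
| JumpZero of operand & nat.

Definition program := seq instr.

Record config := Config {
  pc : nat;
  mem : int -> int;
  inp : seq int;
  out : seq int }.

Definition addr (m : int -> int) (l : location) : int :=
  match l with Direct i => i | Indirect i => m i end.

Definition value (m : int -> int) (a : operand) : int :=
  match a with Lit i => i | Content l => m (addr m l) end.

Definition update (m : int -> int) (i v : int) : int -> int :=
  fun j => if j == i then v else m j.

(* [%/] is Euclidean division on int, with a %/ 0 = 0. *)
Definition arith_eval (op : arith) (a b : int) : int :=
  match op with
  | Add => a + b
  | Sub => a - b
  | Mul => a * b
  | Div => (a %/ b)%Z
  end.

(* Reading past the end of the input yields 0. *)
Definition exec (i : instr) (c : config) : config :=
  let: Config k m w o := c in
  match i with
  | Arith op l a b =>
      Config k.+1 (update m (addr m l) (arith_eval op (value m a) (value m b)))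
             w o
  | Read l => Config k.+1 (update m (addr m l) (head 0 w)) (behead w) o
  | Write a => Config k.+1 m w (rcons o (value m a))
  | Jump j => Config j m w o
  | JumpPos a j => Config (if 0 < value m a then j else k.+1) m w o
  | JumpZero a j => Config (if value m a == 0 then j else k.+1) m w o
  end.

Definition cost_loc (m : int -> int) (l : location) : nat :=
  match l with
  | Direct i => bitlen i
  | Indirect i => (bitlen i + bitlen (m i))%N
  end.

Definition cost_operand (m : int -> int) (a : operand) : nat :=
  match a with
  | Lit i => bitlen i
  | Content l => (cost_loc m l + bitlen (m (addr m l)))%N
  end.

Definition cost (i : instr) (c : config) : nat :=
  let m := mem c in
  match i with
  | Arith _ l a b => (cost_loc m l + cost_operand m a + cost_operand m b)%N
  | Read l => (cost_loc m l + bitlen (head (0 : int)%R (inp c)))%N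
  | Write a => cost_operand m a
  | Jump _ => 1%N
  | JumpPos a _ => cost_operand m a
  | JumpZero a _ => cost_operand m a
  end.

(* [runs P c t o]: from configuration c, P halts (its program counter leaves the
   program) after total cost t, with output tape o. *)
Inductive runs (P : program) : config -> nat -> seq int -> Prop :=
| runs_halt c : (size P <= pc c)%N -> runs P c 0 (out c)
| runs_step c i t o :
    onth P (pc c) = Some i -> runs P (exec i c) t o ->
    runs P c (cost i c + t)%N o.

Definition init (w : seq int) : config := Config 0 (fun=> 0) w [::].

Lemma common_denominator (s : seq int) (p : int -> rat) :
  exists2 D : int, 0 < D & forall F : int -> rat,
    (forall x, F x \is a Num.int) ->
    D%:~R * (\sum_(x <- s) p x * F x) \is a Num.int.
Proof.
elim: s => [|a s [D D0 HD]].
  by exists 1 => // F _; rewrite big_nil mulr0 rpred0.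
exists (denq (p a) * D) => [|F HF]; first by rewrite mulr_gt0 ?denq_gt0.
rewrite big_cons mulrDr rpredD //; last first.
  by rewrite intrM -mulrA rpredM ?HD ?intr_int.
rewrite intrM mulrACA [_ * p a]mulrC -numqE.
by rewrite !rpredM ?HF ?intr_int.
Qed.

Lemma Phi_denominator (K : rat) (pX pZ : massfun) :
  exists2 D : int, 0 < D &
    forall T delta, D%:~R * Phi K pX pZ T delta \is a Num.int.
Proof.
have [D1 D10 H1] := common_denominator (finsupp pX) pX.
have [D2 D20 H2] := common_denominator (finsupp pZ) pZ.
exists (D1 * (D2 * denq K)) => [|T delta]; first by rewrite !mulr_gt0 ?denq_gt0.
rewrite /Phi /expect_indep intrM -mulrA mulr_sumr.
under eq_bigr => x _ do
  [under eq_bigr => z _ do rewrite -mulrA; rewrite -mulr_sumr mulrCA].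
apply: H1 => x; rewrite intrM -mulrA mulr_sumr.
under eq_bigr => z _ do rewrite mulrCA.
apply: H2 => z; rewrite mulrDr [_ * (K * _)]mulrA [_ * K]mulrC -numqE.
by rewrite rpredD // rpredM // ?rpredX ?intr_int.
Qed.

Lemma Phi_ge0 (K : rat) (pX pZ : massfun) T delta :
  is_pmf pX -> is_pmf pZ -> 0 < K -> 0 <= Phi K pX pZ T delta.
Proof.
move=> [pX0 _] [pZ0 _] K0; apply: sumr_ge0 => x _; apply: sumr_ge0 => z _.
by rewrite !mulr_ge0 // addr_ge0 ?sqr_ge0 // mulr_ge0 ?sqr_ge0 // ltW.
Qed.

Lemma Phi_starP (K : rat) (pX pZ : massfun) :
  is_pmf pX -> is_pmf pZ -> 0 < K -> is_min_cost K pX pZ (Phi_star K pX pZ).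
Proof.
move=> hX hZ K0; apply: xgetPex.
have [D D0 HD] := Phi_denominator K pX pZ.
have D0' : 0 < D%:~R :> rat by rewrite ltr0z.
have natP T delta : exists n : nat, D%:~R * Phi K pX pZ T delta = n%:R.
  apply/natrP; rewrite natrEint HD mulr_ge0 ?(ltW D0') //.
  exact: Phi_ge0.
pose P n := `[< exists T delta, D%:~R * Phi K pX pZ T delta = n%:R >].
have exP : exists n, P n.
  have [n Hn] := natP id id; exists n; apply/asboolP; by exists id, id.
case: (ex_minnP exP) => n /asboolP[T [delta Hn]] nmin.
exists (Phi K pX pZ T delta); split; first by exists T, delta.
move=> T' delta'; rewrite -(ler_pM2l D0') Hn.
have [n' Hn'] := natP T' delta'; rewrite Hn' ler_nat.
by apply: nmin; apply/asboolP; exists T', delta'.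
Qed.

(* Main.v *)
Require Import Defs.
From mathcomp Require Import all_boot all_order all_algebra.
From mathcomp Require Import finmap.
From mathcomp Require Import zify ring lra.

Set Implicit Arguments.
Unset Strict Implicit.
Unset Printing Implicit Defensive.

Import Order.TTheory GRing.Theory Num.Theory.

Local Open Scope fset_scope.
Local Open Scope ring_scope.

(** Write n and m for the numbers of support points x of X0 and z of Z, and V
    for the cost of an arbitrary policy.

    The algorithm keeps T x = x for every input x that is not [bad]. An input
    x is bad if some input x' that is at least as probable yields a common
    observation x + z = x' + z', and the smaller weight w among p x * q z and
    p x' * q z' satisfies K w (x - x')^2 > 2 p x. A bad input is moved upwards
    to the first place where its observations T x + z avoid those of all other
    inputs; each other input excludes at most m^2 places, so that x moves by at
    most (n - 1) m^2. Finally delta y is - T x for the heaviest pair (x, z)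
    with T x + z = y.

    The ratio rests on two facts about V. A policy that moves x pays at least
    p x ([move_cost]), because a nonzero displacement is an integer. A policy
    that leaves both x and x' in place pays at least half of K w (x - x')^2,
    since its estimate at the common observation cannot be close to both
    ([pair_cost]). Hence p x <= V for a bad x ([bad_cost]), and
    K w (x - x')^2 <= 2 V for two inputs that are kept ([kept_cost]). Moving
    the bad inputs therefore costs at most n ((n - 1) m^2)^2 V, and the
    estimation errors cost at most 2 n m (m - 1) V: a moved input is never
    confused, and the heaviest pair makes no error itself. The sum is at most
    n^3 m^4 V ([approximation]). No candidate policies are compared and no
    cost is ever computed.

    The machine program is the compiled form of a program in a small language
    with arithmetic expressions, arrays and loops whose numbers of rounds are
    fixed on entry. The compiler is proved correct once ([compile_correct]),
    so that the algorithm can be reasoned about through the denotational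
    semantics [sem]. Polynomial time is read off the syntax: every variable
    and every array has a degree that bounds its values, the degrees are
    checked by computation ([typed]), and the bounds of loops need a degree
    that is polynomial in the length of the input. In a test the rationals are
    compared by cross-multiplication, so that all numbers are obtained
    from a bounded number of inputs by a bounded number of operations. *)

(** * A language of bounded loops *)

Inductive expr :=
| Num of int
| Var of nat
| Arr of nat & expr
| Bin of arith & expr & expr.

Inductive test := Pos of expr | Zero of expr.

Inductive cmd :=
| Asg of nat & expr
| Store of nat & expr & expr
| Input of nat
| Output of expr
| Seq of cmd & cmd
| If of test & cmd
| For of nat & nat & cmd.

Record state := State {
  vars : nat -> int;
  arrs : nat -> int -> int;
  sinp : seq int;
  sout : seq int }.

Definition set_var (v : nat) (a : int) (s : state) : state :=
  State (fun u => if u == v then a else vars s u) (arrs s) (sinp s) (sout s).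

Definition set_arr (c : nat) (i a : int) (s : state) : state :=
  State (vars s)
    (fun d j => if (d == c) && (j == i) then a else arrs s d j)
    (sinp s) (sout s).

Fixpoint eval (s : state) (e : expr) : int :=
  match e with
  | Num a => a
  | Var v => vars s v
  | Arr c e => arrs s c (eval s e)
  | Bin op a b => arith_eval op (eval s a) (eval s b)
  end.

Definition test_expr (t : test) := match t with Pos e | Zero e => e end.

Definition holds (s : state) (t : test) : bool :=
  match t with Pos e => 0 < eval s e | Zero e => eval s e == 0 end.

Definition trips (a : int) : nat := if 0 < a then `|a|%N else 0%N.

(** The number of rounds of a loop is fixed on entry, which makes the semantics
    a total function; compilation respects it because the body of a well-typed
    loop changes neither the index nor the bound. *)
Fixpoint sem (c : cmd) (s : state) : state :=
  match c with
  | Asg v e => set_var v (eval s e) s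
  | Store c e1 e2 => set_arr c (eval s e1) (eval s e2) s
  | Input v =>
      let s' := set_var v (head 0 (sinp s)) s in
      State (vars s') (arrs s') (behead (sinp s)) (sout s)
  | Output e => State (vars s) (arrs s) (sinp s) (rcons (sout s) (eval s e))
  | Seq a b => sem b (sem a s)
  | If t b => if holds s t then sem b s else s
  | For i n b =>
      let N := trips (vars s n) in
      set_var i N%:Z (iteri N (fun k s' => sem b (set_var i k%:Z s')) s)
  end.

Fixpoint assigned (c : cmd) : seq nat :=
  match c with
  | Asg v _ | Input v => [:: v]
  | Store _ _ _ | Output _ => [::]
  | Seq a b => assigned a ++ assigned b
  | If _ b => assigned b
  | For i _ b => i :: assigned b
  end.

Lemma sem_frame c s v : v \notin assigned c -> vars (sem c s) v = vars s v.
Proof.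
elim: c s => [u e|d e1 e2|u|e|a IHa b IHb|t b IHb|i n b IHb] s //=.
- by rewrite inE => /negPf ->.
- by rewrite inE => /negPf ->.
- by rewrite mem_cat negb_or => /andP[va vb]; rewrite IHb // IHa.
- by move=> vb; case: ifP => // _; rewrite IHb.
- rewrite inE negb_or => /andP[/negPf vi vb]; rewrite vi.
  by elim: (trips _) => //= k IHk; rewrite IHb //= vi.
Qed.

(** * Compilation to the machine *)

(** Scalars, temporaries and arrays occupy different residue classes modulo 16,
    so that no index, not even a negative one, can make two of them overlap. *)
Definition var_addr (v : nat) : int := 16 * v%:Z + 15.
Definition tmp_addr (d : nat) : int := 16 * d%:Z + 14.
Definition arr_addr (c : nat) (i : int) : int := 16 * i + c%:Z.

Definition var_reg v := Direct (var_addr v).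
Definition tmp_reg d := Direct (tmp_addr d).
Definition tmp d := Content (tmp_reg d).

Definition index_code (d c : nat) : seq instr :=
  [:: Arith Mul (tmp_reg d) (tmp d) (Lit 16);
      Arith Add (tmp_reg d) (tmp d) (Lit c%:Z)].

Fixpoint compile_expr (d : nat) (e : expr) : seq instr :=
  match e with
  | Num a => [:: Arith Add (tmp_reg d) (Lit a) (Lit 0)]
  | Var v => [:: Arith Add (tmp_reg d) (Content (var_reg v)) (Lit 0)]
  | Arr c e => compile_expr d e ++ index_code d c ++
      [:: Arith Add (tmp_reg d) (Content (Indirect (tmp_addr d))) (Lit 0)]
  | Bin op a b => compile_expr d a ++ compile_expr d.+1 b ++
      [:: Arith op (tmp_reg d) (tmp d) (tmp d.+1)]
  end.

Definition assign_code v e : seq instr :=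
  rcons (compile_expr 0 e) (Arith Add (var_reg v) (tmp 0) (Lit 0)).

(** Failure jumps away and success falls through, so that the guarded code can
    follow directly. The position k is needed because jumps are absolute. *)
Definition test_code (k : nat) (t : test) (target : nat) : seq instr :=
  let ce := compile_expr 0 (test_expr t) in
  let l := (k + size ce).+2 in
  ce ++ [:: match t with
            | Pos _ => JumpPos (tmp 0) l
            | Zero _ => JumpZero (tmp 0) l
            end; Jump target].

Definition less i n : test := Pos (Bin Defs.Sub (Var n) (Var i)).
Definition incr i : expr := Bin Add (Var i) (Num 1).

Arguments index_code : simpl never.
Arguments assign_code : simpl never.
Arguments test_code : simpl never.

Fixpoint length_of (c : cmd) : nat :=
  match c with
  | Asg v e => size (assign_code v e)
  | Store _ e1 e2 => size (compile_expr 0 e1) + size (compile_expr 1 e2) + 3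
  | Input _ => 1
  | Output e => size (compile_expr 0 e) + 1
  | Seq a b => length_of a + length_of b
  | If t b => size (compile_expr 0 (test_expr t)) + 2 + length_of b
  | For i n b => size (assign_code i (Num 0))
      + (size (compile_expr 0 (test_expr (less i n))) + 2) + length_of b
      + size (assign_code i (incr i)) + 1
  end%N.

Fixpoint compile (k : nat) (c : cmd) : seq instr :=
  match c with
  | Asg v e => assign_code v e
  | Store c e1 e2 => compile_expr 0 e1 ++ compile_expr 1 e2 ++
      index_code 0 c ++
      [:: Arith Add (Indirect (tmp_addr 0)) (tmp 1) (Lit 0)]
  | Input v => [:: Read (var_reg v)]
  | Output e => rcons (compile_expr 0 e) (Write (tmp 0))
  | Seq a b => compile k a ++ compile (k + length_of a) b
  | If t b =>
      let l := (k + size (compile_expr 0 (test_expr t)) + 2)%N in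
      test_code k t (l + length_of b)%N ++ compile l b
  | For i n b =>
      let k1 := (k + size (assign_code i (Num 0)))%N in
      let k2 := (k1 + (size (compile_expr 0 (test_expr (less i n))) + 2))%N in
      let k3 := (k2 + length_of b + size (assign_code i (incr i)) + 1)%N in
      assign_code i (Num 0) ++ test_code k1 (less i n) k3 ++ compile k2 b ++
      assign_code i (incr i) ++ [:: Jump k1]
  end.

Lemma size_compile k c : size (compile k c) = length_of c.
Proof.
elim: c k => [v e|c e1 e2|v|e|a IHa b IHb|t b IHb|i n b IHb] k //=;
  rewrite ?size_cat ?size_rcons /= ?size_cat ?IHa ?IHb /=; lia.
Qed.

Definition code_at (P : program) (k : nat) (code : seq instr) :=
  forall i x, onth code i = Some x -> onth P (k + i) = Some x.

Lemma code_at_cat P k a b :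
  code_at P k (a ++ b) <-> code_at P k a /\ code_at P (k + size a) b.
Proof.
split=> [h|[ha hb] i x].
  split=> i x hi.
    apply: h; rewrite onth_cat; case: ltnP => // hs.
    by move: hi; rewrite onth_default.
  by rewrite -addnA; apply: h; rewrite onth_cat ltnNge leq_addr addKn.
rewrite onth_cat; case: ltnP => hs hi; first exact: ha.
by rewrite -(subnKC hs) addnA; apply: hb.
Qed.

Lemma code_at_cons P k x a :
  code_at P k (x :: a) <-> onth P k = Some x /\ code_at P k.+1 a.
Proof.
rewrite -cat1s; split=> [/code_at_cat[h1 h2]|[h1 h2]].
  split; first by have := h1 0%N x erefl; rewrite addn0.
  by move: h2; rewrite addn1.
apply/code_at_cat; split; last by rewrite addn1.
by case=> [|[]] y //= [<-]; rewrite addn0.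
Qed.

Lemma code_at_rcons P k a x :
  code_at P k (rcons a x) <-> code_at P k a /\ onth P (k + size a) = Some x.
Proof.
rewrite -cats1; split=> [/code_at_cat[h1 /code_at_cons[]]//|[h1 h2]].
by apply/code_at_cat; split=> //; apply/code_at_cons; split=> // -[].
Qed.

Lemma code_at_seq P k a b : code_at P k (compile k (Seq a b)) ->
  code_at P k (compile k a) /\
  code_at P (k + length_of a) (compile (k + length_of a) b).
Proof. by case/code_at_cat; rewrite size_compile. Qed.

(** The running time is split into a number of instructions n, which the syntax
    bounds, and a price u for each of them, which the size of the values
    bounds. *)
Inductive reach (P : program) (u : nat) : config -> nat -> config -> Prop :=
| reach_refl c n : reach P u c n c
| reach_step c i n c' :
    onth P (pc c) = Some i -> (cost i c <= u)%N ->
    reach P u (exec i c) n c' -> reach P u c n.+1 c'.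

Lemma reach_trans P u c1 n1 c2 n2 c3 :
  reach P u c1 n1 c2 -> reach P u c2 n2 c3 -> reach P u c1 (n1 + n2) c3.
Proof.
elim=> {c1 n1 c2} [c n|c i n c' hi hc h IH] h23; last first.
  by rewrite addSn; apply: reach_step hi hc _; apply: IH.
elim: h23 => {c c3} [c m|c i m c' hi hc _ IH]; first exact: reach_refl.
by rewrite addnS; apply: reach_step hi hc IH.
Qed.

Lemma reach_weaken P u c n n' c' :
  (n <= n')%N -> reach P u c n c' -> reach P u c n' c'.
Proof.
move=> le_nn' h; rewrite -(subnKC le_nn').
exact: reach_trans h (reach_refl _ _ _ _).
Qed.

Lemma reach_runs P u c n c' :
  reach P u c n c' -> (size P <= pc c')%N ->
  exists2 t, (t <= n * u)%N & runs P c t (out c').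
Proof.
move=> h halted; elim: h halted => {c n c'} [c n|c i n c' hi hc _ IH] halted.
  by exists 0%N => //; apply: runs_halt.
have [t ht hr] := IH halted; exists (cost i c + t)%N; last exact: runs_step hi hr.
by rewrite mulSn leq_add.
Qed.

(** Nothing is said about temporaries: none of them is live between two
    commands. *)
Record represents (s : state) (c : config) : Prop := Represents {
  rep_vars : forall v, Defs.mem c (var_addr v) = vars s v;
  rep_arrs : forall a i, (a < 14)%N -> Defs.mem c (arr_addr a i) = arrs s a i;
  rep_inp : inp c = sinp s;
  rep_out : out c = sout s }.

Lemma mem_var s k m w o v :
  represents s (Config k m w o) -> m (var_addr v) = vars s v.
Proof. by case. Qed.

Lemma mem_arr s k m w o a i :
  represents s (Config k m w o) -> (a < 14)%N ->
  m (arr_addr a i) = arrs s a i.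
Proof. by case=> _ h _ _; apply: h. Qed.

Lemma represents_tmp s k m w o k' d a :
  represents s (Config k m w o) ->
  represents s (Config k' (update m (tmp_addr d) a) w o).
Proof.
case=> /= hv ha hi ho; split=> //= [v|b i hb]; rewrite /update.
  by rewrite ifF ?hv // /var_addr /tmp_addr; lia.
by rewrite ifF ?ha // /arr_addr /tmp_addr; lia.
Qed.

Lemma represents_pc s k m w o k' :
  represents s (Config k m w o) -> represents s (Config k' m w o).
Proof. by case. Qed.

Lemma represents_var s k m w o k' v a :
  represents s (Config k m w o) ->
  represents (set_var v a s) (Config k' (update m (var_addr v) a) w o).
Proof.
case=> /= hv ha hi ho; split=> //= [u|b i hb]; rewrite /update.
  rewrite -hv; have -> // : (var_addr u == var_addr v) = (u == v).
  by rewrite /var_addr; lia.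
by rewrite ifF ?ha // /arr_addr /var_addr; lia.
Qed.

Lemma represents_arr s k m w o k' c i a : (c < 14)%N ->
  represents s (Config k m w o) ->
  represents (set_arr c i a s) (Config k' (update m (arr_addr c i) a) w o).
Proof.
move=> hc [/= hv ha hi ho]; split=> //= [u|b j hb]; rewrite /update.
  by rewrite ifF ?hv // /arr_addr /var_addr; lia.
rewrite -ha //.
have -> // : (arr_addr b j == arr_addr c i) = (b == c) && (j == i).
by rewrite /arr_addr; lia.
Qed.

(** * Static bounds on values and running time *)

(** A degree [(a, b)] stands for the bound S^a * 2^(S b) on absolute values,
    where S exceeds the length of the input: loop counts need degree [(a, 0)],
    which is polynomial, while the numbers of the input have degree [(0, 1)]. *)
Definition degree : Type := nat * nat.

Definition deg_le (d e : degree) : bool := (d.1 <= e.1)%N && (d.2 <= e.2)%N.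
Definition weight (d : degree) : nat := d.1 + d.2.

Section StaticBounds.

Variables (gamma alpha : nat -> degree) (E : nat).

Fixpoint deg (e : expr) : degree :=
  match e with
  | Num _ => (1, 0)%N
  | Var v => gamma v
  | Arr c _ => alpha c
  | Bin Mul a b => ((deg a).1 + (deg b).1, (deg a).2 + (deg b).2)%N
  | Bin _ a b =>
      ((maxn (deg a).1 (deg b).1).+1, maxn (deg a).2 (deg b).2)
  end.

(** The array case leaves room for the two steps that turn an index into an
    address. *)
Fixpoint typed_expr (e : expr) : bool :=
  match e with
  | Num a => (`|a| <= 16)%N && (0 < E)%N
  | Var v => (v < 1000)%N && (weight (gamma v) <= E)%N
  | Arr c e => [&& (c < 14)%N, typed_expr e, (weight (deg e) + 2 <= E)%N
                 & (weight (alpha c) <= E)%N]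
  | Bin op a b => [&& typed_expr a, typed_expr b,
      (weight (deg (Bin op a b)) <= E)%N
      & if op is Div then false else true]
  end.

Fixpoint depth (e : expr) : nat :=
  match e with
  | Num _ | Var _ => 1
  | Arr _ e => depth e
  | Bin _ a b => maxn (depth a) (depth b).+1
  end.

Lemma depth_gt0 e : (0 < depth e)%N.
Proof. by elim: e => //= _ a ha b _; rewrite leq_max ha. Qed.

Definition shallow e := typed_expr e && (depth e <= 100)%N.

(** A counter incremented in a loop has no degree of its own; it gets one from
    the test that guards the increment. *)
Definition capped_incr (t : test) (b : cmd) : bool :=
  match t, b with
  | Pos (Bin Defs.Sub e (Var c1)), Asg c2 (Bin Add (Var c3) (Num a)) =>
      [&& c1 == c2, c3 == c2, a == 1, (c2 < 1000)%N,
          deg_le (deg e) (gamma c2) & shallow (incr c2)]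
  | _, _ => false
  end.

Fixpoint typed (c : cmd) : bool :=
  match c with
  | Asg v e => [&& (v < 1000)%N, shallow e & deg_le (deg e) (gamma v)]
  | Store c e1 e2 => [&& (c < 14)%N, shallow e1, shallow e2,
      (weight (deg e1) + 2 <= E)%N & deg_le (deg e2) (alpha c)]
  | Input v => (v < 1000)%N && deg_le (0, 1)%N (gamma v)
  | Output e => shallow e
  | Seq a b => typed a && typed b
  | If t b => shallow (test_expr t) && (typed b || capped_incr t b)
  | For i n b => [&& (i < 1000)%N, (gamma n).2 == 0%N,
      deg_le (gamma n) (gamma i), shallow (test_expr (less i n)),
      shallow (incr i), shallow (Num 0), i \notin assigned b,
      n \notin assigned b, i != n & typed b]
  end.

Lemma capped_incrP t b : capped_incr t b ->
  exists e c, [/\ t = Pos (Bin Defs.Sub e (Var c)), b = Asg c (incr c), (c < 1000)%N,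
    deg_le (deg e) (gamma c) & shallow (incr c)].
Proof.
case: t => // -[//|//|//|] [] //= e [] // c1.
case: b => // c2 [] // [] // [] // c3 [] // a /and5P[/eqP-> /eqP-> /eqP-> h].
by case/andP=> h1 h2; exists e, c2.
Qed.

Variable S : nat.
Hypothesis S_ge16 : (16 <= S)%N.
Hypothesis E_gt0 : (0 < E)%N.

Definition bound (d : degree) : nat := (S ^ d.1 * 2 ^ (S * d.2))%N.

Definition bounded (s : state) : Prop :=
  [/\ forall v, (`|vars s v| <= bound (gamma v))%N,
      forall c i, (`|arrs s c i| <= bound (alpha c))%N
    & all (fun a : int => (`|a| <= bound (0, 1))%N) (sinp s)].

Lemma bound_gt0 d : (0 < bound d)%N.
Proof. by rewrite muln_gt0 !expn_gt0 (leq_trans _ S_ge16). Qed.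

Lemma bound_le d e : deg_le d e -> (bound d <= bound e)%N.
Proof.
move=> /andP[h1 h2]; rewrite leq_mul // leq_pexp2l //; last by rewrite leq_mul.
exact: leq_trans S_ge16.
Qed.

Lemma boundS d : bound (d.1.+1, d.2) = (S * bound d)%N.
Proof. by rewrite /bound /= expnS mulnA. Qed.

Lemma bound_mul d e :
  bound (d.1 + e.1, d.2 + e.2)%N = (bound d * bound e)%N.
Proof. by rewrite /bound /= expnD mulnDr expnD mulnACA. Qed.

Definition width : nat := (S * E).+1.
Definition fits (a : int) : Prop := (`|a| <= 2 ^ (S * E))%N.

Lemma fits_bitlen a : fits a -> (bitlen a <= width)%N.
Proof.
by move=> h; rewrite ltnS -(@trunc_expnK 2 (S * E)) //; apply: leq_trunc_log.
Qed.

Lemma bound_fits a d :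
  (weight d <= E)%N -> (`|a| <= bound d)%N -> fits a.
Proof.
move=> hd h; apply: leq_trans h _.
apply: (@leq_trans (2 ^ (S * weight d))); last first.
  by rewrite leq_exp2l // leq_mul.
rewrite /bound /weight mulnDr expnD leq_mul // expnM.
case: (posnP d.1) => [->//|d_gt0]; rewrite leq_exp2r //.
exact/ltnW/ltn_expl.
Qed.

Lemma eval_bounded s e :
  bounded s -> typed_expr e -> (`|eval s e| <= bound (deg e))%N.
Proof.
case=> hv ha _; elim: e => [a|v|c e _|op a IHa b IHb] /= => [/andP[h _]|_|_|].
- by rewrite /bound /= muln0 expn1 muln1; apply: leq_trans h S_ge16.
- exact: hv.
- exact: ha.
case/and4P=> /IHa ka /IHb kb _ hop.
have sum : (`|eval s a| + `|eval s b| <=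
    bound ((maxn (deg a).1 (deg b).1).+1, maxn (deg a).2 (deg b).2))%N.
  have -> := boundS (maxn (deg a).1 (deg b).1, maxn (deg a).2 (deg b).2).
  apply: (@leq_trans (2 * bound
      (maxn (deg a).1 (deg b).1, maxn (deg a).2 (deg b).2))); last first.
    by rewrite leq_mul2r (leq_trans _ S_ge16) ?orbT.
  rewrite mul2n -addnn leq_add //.
    by apply: leq_trans ka (bound_le _); rewrite /deg_le /= !leq_maxl.
  by apply: leq_trans kb (bound_le _); rewrite /deg_le /= !leq_maxr.
case: op hop => //= _.
- apply: leq_trans sum; clear; move: (eval s a) (eval s b) => x y; lia.
- apply: leq_trans sum; clear; move: (eval s a) (eval s b) => x y; lia.
- by rewrite abszM bound_mul leq_mul.
Qed.

Lemma eval_fits s e : bounded s -> typed_expr e -> fits (eval s e).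
Proof.
move=> hs ht; apply: bound_fits (eval_bounded hs ht).
by case: e ht => [a /andP[_]|v /andP[]|c e /and4P[]|op a b /and4P[]] //=;
  rewrite /weight.
Qed.

Lemma small_fits a : (`|a| <= 2 ^ 16)%N -> fits a.
Proof.
move=> h; apply: leq_trans h _; rewrite leq_exp2l //.
by rewrite (leq_trans S_ge16) // leq_pmulr.
Qed.

Lemma var_addr_fits v : (v < 1000)%N -> fits (var_addr v).
Proof. by move=> h; apply: small_fits; rewrite /var_addr; lia. Qed.

Lemma tmp_addr_fits d : (d < 1000)%N -> fits (tmp_addr d).
Proof. by move=> h; apply: small_fits; rewrite /tmp_addr; lia. Qed.

Lemma lit_fits a : (`|a| <= 16)%N -> fits a.
Proof. by move=> h; apply: small_fits; lia. Qed.

Lemma index_fits d a c : (c < 14)%N -> (weight d + 2 <= E)%N ->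
  (`|a| <= bound d)%N -> fits (a * 16) /\ fits (arr_addr c a).
Proof.
move=> hc hd ha.
have h2 : (`|a| * 16 + 16 <= bound (d.1.+2, d.2))%N.
  have -> := boundS (d.1.+1, d.2); have -> := boundS d.
  rewrite mulnA; apply: (@leq_trans (32 * bound d)).
    by have := bound_gt0 d; move: ha; clear; lia.
  rewrite leq_mul2r; apply/orP; right.
  by apply: (@leq_trans (16 * 16)) => //; apply: leq_mul.
by split; apply: (@bound_fits _ (d.1.+2, d.2));
  rewrite /weight /arr_addr; move: hd h2; rewrite /weight /=; lia.
Qed.

Definition unit_cost : nat := 8 * width.

Section Simulation.

Variable P : program.

Local Notation reach := (reach P unit_cost).

Lemma reach1 i n k m w o : onth P k = Some i ->
  (cost i (Config k m w o) <= unit_cost)%N ->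
  reach (Config k m w o) n.+1 (exec i (Config k m w o)).
Proof. by move=> h hc; apply: reach_step; [exact: h | exact: hc | exact: reach_refl]. Qed.

(** The intermediate product has to fit as well, since reading it is charged. *)
Lemma index_code_correct s d a c n k m w o :
  code_at P k (index_code d c) -> (d < 1000)%N -> (c < 14)%N ->
  fits a -> fits (a * 16) -> represents s (Config k m w o) ->
  m (tmp_addr d) = a ->
  exists m', [/\ reach (Config k m w o) n.+2 (Config k.+2 m' w o),
    represents s (Config k.+2 m' w o), m' (tmp_addr d) = arr_addr c a
    & forall j, j != tmp_addr d -> m' j = m j].
Proof.
move=> /code_at_cons[h1 /code_at_cons[h2 _]] hd hc fa fa16 rep ma.
pose m1 := update m (tmp_addr d) (a * 16).
exists (update m1 (tmp_addr d) (arr_addr c a)).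
have bd := fits_bitlen (tmp_addr_fits hd).
have ba := fits_bitlen fa; have ba16 := fits_bitlen fa16.
have b16 := fits_bitlen (lit_fits (isT : (`|16 : int| <= 16)%N)).
have bc : (bitlen c%:Z <= width)%N by apply/fits_bitlen/lit_fits; lia.
split.
- apply: reach_step; [exact: h1 | by rewrite /= ma /unit_cost; lia | ].
  have step2 : exec (Arith Add (tmp_reg d) (tmp d) (Lit c%:Z))
      (Config k.+1 m1 w o) =
      Config k.+2 (update m1 (tmp_addr d) (arr_addr c a)) w o.
    rewrite /= /arr_addr; congr (Config _ (update _ _ _) _ _).
    by rewrite /m1 /update eqxx mulrC.
  rewrite /= ma -step2; apply: reach1 => //=.
  by rewrite /m1 /update eqxx /unit_cost; lia.
- exact: represents_tmp (represents_tmp k _ _ rep).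
- by rewrite /update eqxx.
- by move=> j /negPf hj; rewrite /m1 /update hj.
Qed.

(** Temporaries below d are preserved: they hold the left operands of the
    enclosing operations. *)
Lemma compile_expr_correct s e d k m w o :
  bounded s -> typed_expr e -> (d + depth e <= 1000)%N ->
  code_at P k (compile_expr d e) -> represents s (Config k m w o) ->
  let k' := (k + size (compile_expr d e))%N in
  exists m', [/\ reach (Config k m w o) (size (compile_expr d e))
                   (Config k' m' w o),
    represents s (Config k' m' w o), m' (tmp_addr d) = eval s e
    & forall d', (d' < d)%N -> m' (tmp_addr d') = m (tmp_addr d')].
Proof.
have b0 := fits_bitlen (lit_fits (isT : (`|0 : int| <= 16)%N)).
have tmp_neq d1 d2 : (d1 < d2)%N -> (tmp_addr d1 == tmp_addr d2) = false.
  by rewrite /tmp_addr; lia.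
move=> hs; elim: e d k m => [a|v|c e IHe|op a IHa b IHb] d k m.
- move=> ht hd /code_at_cons[h _] rep /=; exists (update m (tmp_addr d) a).
  rewrite /= addn1; split; last 2 first.
  + by rewrite /update eqxx.
  + by move=> d' hd'; rewrite /update tmp_neq.
  + have := @reach1 _ 0 _ m w o h; rewrite /= addr0; apply.
    have ba := fits_bitlen (eval_fits hs ht).
    have bd : (bitlen (tmp_addr d) <= width)%N.
      by apply/fits_bitlen/tmp_addr_fits; rewrite /= in hd; lia.
    by rewrite /unit_cost; move: ba bd => /=; lia.
  + exact: represents_tmp rep.
- move=> ht hd /code_at_cons[h _] rep /=.
  exists (update m (tmp_addr d) (vars s v)).
  rewrite /= addn1; split; last 2 first.
  + by rewrite /update eqxx.
  + by move=> d' hd'; rewrite /update tmp_neq.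
  + have := @reach1 _ 0 _ m w o h; rewrite /= (mem_var _ rep) addr0; apply.
    have ba := fits_bitlen (eval_fits hs ht).
    have bd : (bitlen (tmp_addr d) <= width)%N.
      by apply/fits_bitlen/tmp_addr_fits; rewrite /= in hd; lia.
    have bv : (bitlen (var_addr v) <= width)%N.
      by apply/fits_bitlen/var_addr_fits; case/andP: ht.
    by rewrite /unit_cost; move: ba => /=; lia.
  + exact: represents_tmp rep.
- move=> ht hd /code_at_cat[h1 /code_at_cat[h2 /code_at_cons[h3 _]]] rep.
  have -> : size (compile_expr d (Arr c e)) =
      (size (compile_expr d e) + 2 + 1)%N by rewrite /= size_cat -addnA.
  rewrite /= !addnA in hd *.
  case/and4P: (ht) => hc hte hw hw2.
  have [m1 [r1 rep1 v1 p1]] := IHe d k m hte hd h1 rep.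
  have d_lt : (d < 1000)%N by have := depth_gt0 e; clear -hd; lia.
  have [fa fa'] := index_fits hc hw (eval_bounded hs hte).
  have [m2 [r2 rep2 v2 p2]] :=
    index_code_correct 0 h2 d_lt hc (eval_fits hs hte) fa rep1 v1.
  exists (update m2 (tmp_addr d) (arrs s c (eval s e))); split.
  + apply: reach_trans; first exact: reach_trans r1 r2.
    rewrite /= !addn2 in h3 *.
    have := @reach1 _ 0 _ m2 w o h3; rewrite /= v2 (mem_arr _ rep2) // addr0.
    rewrite addn1; apply.
    have bd := fits_bitlen (tmp_addr_fits d_lt).
    have ba := fits_bitlen (eval_fits hs ht).
    have bi := fits_bitlen fa'.
    by rewrite /unit_cost; move: ba => /=; lia.
  + exact: represents_tmp rep2.
  + by rewrite /update eqxx.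
  + by move=> d' hd'; rewrite /update tmp_neq // p2 ?tmp_neq // p1.
- move=> ht hd /code_at_cat[h1 /code_at_cat[h2 /code_at_cons[h3 _]]] rep.
  have -> : size (compile_expr d (Bin op a b)) = (size (compile_expr d a) +
      size (compile_expr d.+1 b) + 1)%N by rewrite /= !size_cat -addnA.
  rewrite /= !addnA in hd *.
  case/and4P: (ht) => hta htb _ hop.
  have [m1 [r1 rep1 v1 p1]] :=
    IHa d k m hta ltac:(by clear -hd; lia) h1 rep.
  have [m2 [r2 rep2 v2 p2]] :=
    IHb d.+1 _ m1 htb ltac:(by clear -hd; lia) h2 rep1.
  exists (update m2 (tmp_addr d) (eval s (Bin op a b))); split.
  + apply: reach_trans; first exact: reach_trans r1 r2.
    have := @reach1 _ 0 _ m2 w o h3; rewrite /= v2 p2 // v1 addn1; apply.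
    have d_lt : (d < 1000)%N by have := depth_gt0 a; clear -hd; lia.
    have d1_lt : (d.+1 < 1000)%N by have := depth_gt0 b; clear -hd; lia.
    have bd := fits_bitlen (tmp_addr_fits d_lt).
    have bd1 := fits_bitlen (tmp_addr_fits d1_lt).
    have ba := fits_bitlen (eval_fits hs hta).
    have bb := fits_bitlen (eval_fits hs htb).
    by rewrite /unit_cost; lia.
  + exact: represents_tmp rep2.
  + by rewrite /update eqxx.
  + by move=> d' hd'; rewrite /update tmp_neq // p2 ?p1 // ltnS ltnW.
Qed.

Lemma shallow_typed e : shallow e -> typed_expr e.
Proof. by case/andP. Qed.

Lemma shallow_depth d e :
  shallow e -> (d <= 900)%N -> (d + depth e <= 1000)%N.
Proof. by case/andP=> _; lia. Qed.

Lemma assign_code_correct v e s k m w o :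
  bounded s -> (v < 1000)%N -> shallow e ->
  code_at P k (assign_code v e) -> represents s (Config k m w o) ->
  let k' := (k + size (assign_code v e))%N in
  exists2 m', reach (Config k m w o) (size (assign_code v e))
                (Config k' m' w o)
    & represents (set_var v (eval s e) s) (Config k' m' w o).
Proof.
move=> hs hv he /code_at_rcons[h1 h2] rep.
have ht := shallow_typed he.
have [m1 [r1 rep1 v1 _]] :=
  compile_expr_correct hs ht (shallow_depth (d := 0) he isT) h1 rep.
exists (update m1 (var_addr v) (eval s e)); last exact: represents_var rep1.
rewrite /= size_rcons -addn1; apply: reach_trans r1 _.
have := @reach1 _ 0 _ m1 w o h2; rewrite /= v1 addr0 addn1 addnS; apply.
have b0 := fits_bitlen (lit_fits (isT : (`|0 : int| <= 16)%N)).
have bv := fits_bitlen (var_addr_fits hv).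
have ba := fits_bitlen (eval_fits hs ht).
have bt := fits_bitlen (tmp_addr_fits (isT : (0 < 1000)%N)).
by rewrite /unit_cost; lia.
Qed.

Lemma test_code_correct t target s k m w o :
  bounded s -> shallow (test_expr t) ->
  code_at P k (test_code k t target) -> represents s (Config k m w o) ->
  let l := (size (compile_expr 0 (test_expr t)) + 2)%N in
  let k' := if holds s t then (k + l)%N else target in
  exists2 m', reach (Config k m w o) l (Config k' m' w o)
    & represents s (Config k' m' w o).
Proof.
move=> hs he /code_at_cat[h1 /code_at_cons[h2 /code_at_cons[h3 _]]] rep.
have ht := shallow_typed he.
have [m1 [r1 rep1 v1 _]] :=
  compile_expr_correct hs ht (shallow_depth (d := 0) he isT) h1 rep.
exists m1; last exact: represents_pc rep1.
rewrite /=; apply: reach_trans r1 _.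
have ba := fits_bitlen (eval_fits hs ht).
have bt := fits_bitlen (tmp_addr_fits (isT : (0 < 1000)%N)).
have cost_ok : (bitlen (tmp_addr 0) + bitlen (eval s (test_expr t)) <=
    unit_cost)%N by rewrite /unit_cost; lia.
apply: reach_step; [exact: h2 | | ].
  by case: t {h1 h2 h3 he ht rep1 ba} v1 cost_ok => e /= ->.
have -> : exec (match t with
            | Pos _ => JumpPos (tmp 0) (k + size (compile_expr 0 (test_expr t))).+2
            | Zero _ => JumpZero (tmp 0) (k + size (compile_expr 0 (test_expr t))).+2
            end)
    (Config (k + size (compile_expr 0 (test_expr t))) m1 w o) =
  Config (if holds s t then (k + size (compile_expr 0 (test_expr t))).+2
          else (k + size (compile_expr 0 (test_expr t))).+1) m1 w o.
  by case: t {h1 h2 h3 he ht rep1 ba cost_ok} v1 => e /= ->.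
case: (holds s t); first by rewrite addnA addn2; apply: reach_refl.
by apply: reach_step; [exact: h3 | rewrite /= /unit_cost /width; lia
  | exact: reach_refl].
Qed.

Lemma bounded_set_var v a s : (`|a| <= bound (gamma v))%N ->
  bounded s -> bounded (set_var v a s).
Proof.
by move=> ha [hv hr hi]; split=> // u /=; case: eqP => [->|_].
Qed.

Lemma bounded_set_arr c i a s : (`|a| <= bound (alpha c))%N ->
  bounded s -> bounded (set_arr c i a s).
Proof.
by move=> ha [hv hr hi]; split=> // d j /=; case: ifP => // /andP[/eqP-> _].
Qed.

Lemma ltn_trips k a : (k < trips a)%N = (0 < a - k%:Z).
Proof. by rewrite /trips; case: ifP; lia. Qed.

Lemma loop_index_bounded i n k s : deg_le (gamma n) (gamma i) ->
  bounded s -> (k <= trips (vars s n))%N -> (`|k%:Z| <= bound (gamma i))%N.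
Proof.
move=> hd [hv _ _] hk; apply: leq_trans (bound_le hd).
apply: leq_trans (hv n); rewrite absz_nat; apply: leq_trans hk _.
by rewrite /trips; case: ifP.
Qed.

(** Boundedness is an invariant, so no value grows with the number of rounds:
    an assignment computes from variables whose degrees are fixed in advance,
    an index never exceeds the bound of its loop, and a counter stops at the
    value in its guard. *)
Lemma bounded_sem c s : typed c -> bounded s -> bounded (sem c s).
Proof.
elim: c s => [v e|c e1 e2|v|e|a IHa b IHb|t b IHb|i n b IHb] s /=.
- case/and3P=> _ /shallow_typed he hd hs; apply: bounded_set_var => //.
  exact: leq_trans (eval_bounded hs he) (bound_le hd).
- case/and5P=> _ _ /shallow_typed he _ hd hs; apply: bounded_set_arr => //.
  exact: leq_trans (eval_bounded hs he) (bound_le hd).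
- case/andP=> _ hd [hv ha hi]; split=> //= [u|]; last first.
    by move: hi; case: (sinp s) => //= a l /andP[].
  case: eqP => // ->; apply: leq_trans (bound_le hd).
  move: hi; case: (sinp s) => [_|a l /andP[]//] /=.
  exact: leq_trans (bound_gt0 _).
- by move=> _ [].
- by case/andP=> ha hb hs; apply: IHb => //; apply: IHa.
- case/andP=> ht hb hs; case: ifP => // hold.
  case/orP: hb => [hb|]; first exact: IHb.
  case/capped_incrP=> e [c [et -> _ hd _]] /=; subst t.
  apply: bounded_set_var => //.
  case/andP: ht => /= /and4P[/(eval_bounded hs) he _ _ _] _.
  move: hold => /=; have := bound_le hd; case: hs => /(_ c) hv _ _.
  move: (vars s c) (eval s e) (bound _) (bound _) hv he; clear; lia.
- case/and5P=> _ _ hd _ /and5P[_ _ _ _] /andP[_ hb] hs.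
  apply: bounded_set_var; first exact: loop_index_bounded hs (leqnn _).
  have: (trips (vars s n) <= trips (vars s n))%N by [].
  elim: {1 3}(trips _) => //= k IHk hk; apply: IHb => //.
  apply: bounded_set_var; first exact: loop_index_bounded hs (ltnW hk).
  exact: IHk (ltnW hk).
Qed.

(** A loop counts for S^a rounds, where [(a, 0)] is the degree of its bound. *)
Fixpoint step_bound (c : cmd) : nat :=
  match c with
  | Seq a b => step_bound a + step_bound b
  | If t b => size (compile_expr 0 (test_expr t)) + 2 + step_bound b
  | For i n b => size (assign_code i (Num 0))
      + S ^ (gamma n).1 * (size (compile_expr 0 (test_expr (less i n))) + 2
                  + step_bound b + size (assign_code i (incr i)) + 1)
      + (size (compile_expr 0 (test_expr (less i n))) + 2)
  | _ => length_of c
  end%N.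

Lemma compile_correct c s k cfg :
  typed c -> code_at P k (compile k c) -> bounded s ->
  represents s cfg -> pc cfg = k ->
  exists2 cfg', reach cfg (step_bound c) cfg'
    & represents (sem c s) cfg' /\ pc cfg' = (k + length_of c)%N.
Proof.
elim: c s k cfg => [v e|c e1 e2|v|e|a IHa b IHb|t b IHb|i n b IHb]
  s k [k0 m w o] ht hc hs rep /= e0; subst k0.
- case/and3P: ht => hv he _.
  have [m' r rep'] := assign_code_correct hs hv he hc rep.
  by exists (Config (k + size (assign_code v e)) m' w o).
- case/and5P: ht => hcl he1 he2 hw _.
  have [h1 /code_at_cat[h2 /code_at_cat[h3 /code_at_cons[h4 _]]]] :=
    (code_at_cat _ _ _ _).1 hc.
  have [m1 [r1 rep1 v1 _]] := compile_expr_correct hs (shallow_typed he1)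
    (shallow_depth (d := 0) he1 isT) h1 rep.
  have [m2 [r2 rep2 v2 p2]] := compile_expr_correct hs (shallow_typed he2)
    (shallow_depth (d := 1) he2 isT) h2 rep1.
  have v1' : m2 (tmp_addr 0) = eval s e1 by rewrite p2.
  have [fa fa'] := index_fits hcl hw (eval_bounded hs (shallow_typed he1)).
  have [m3 [r3 rep3 v3 p3]] := index_code_correct 0 h3 isT hcl
    (eval_fits hs (shallow_typed he1)) fa rep2 v1'.
  exists (Config (k + (size (compile_expr 0 e1) + size (compile_expr 1 e2) + 3))
     (update m3 (arr_addr c (eval s e1)) (eval s e2)) w o); last first.
    by split=> //; apply: represents_arr rep3.
  rewrite -[3%N]/(2 + 1)%N !addnA.
  apply: reach_trans; first apply: reach_trans r3; first exact: reach_trans r1 r2.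
  rewrite -!addnA /= addnA in h4; rewrite !addnA in h4.
  have := @reach1 _ 0 _ m3 w o h4; rewrite /= v3 p3 //.
  rewrite v2 addr0 !addn2 addn1; apply.
  have b0 := fits_bitlen (lit_fits (isT : (`|0 : int| <= 16)%N)).
  have bt := fits_bitlen (tmp_addr_fits (isT : (0 < 1000)%N)).
  have bt1 := fits_bitlen (tmp_addr_fits (isT : (1 < 1000)%N)).
  have bi := fits_bitlen fa'.
  have ba := fits_bitlen (eval_fits hs (shallow_typed he2)).
  by rewrite /unit_cost; lia.
- case/andP: ht => hv _; case: rep => /= hmv hma hi ho; subst w o.
  have h1 : onth P k = Some (Read (var_reg v)) by case/code_at_cons: hc.
  exists (exec (Read (var_reg v)) (Config k m (sinp s) (sout s))).
    apply: reach1 h1 _ => /=.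
    have bv := fits_bitlen (var_addr_fits hv).
    suff /fits_bitlen bh : fits (head 0 (sinp s)).
      by move: bv bh; rewrite /unit_cost; move: (bitlen _) (bitlen _); lia.
    case: hs => _ _; case: (sinp s) => [_|a l /andP[ha _]].
      by apply: lit_fits.
    by apply: bound_fits ha; rewrite /weight.
  split=> /=; last by rewrite addn1.
  have := @represents_var s k m (sinp s) (sout s) k.+1 v (head 0 (sinp s)).
  by case=> //=; split.
- case/code_at_rcons: hc => h1 h2.
  have [m1 [r1 rep1 v1 _]] := compile_expr_correct hs (shallow_typed ht)
    (shallow_depth (d := 0) ht isT) h1 rep.
  exists (exec (Write (tmp 0))
            (Config (k + size (compile_expr 0 e)) m1 w o)).
    apply: reach_trans r1 _; apply: reach1 h2 _.
    have bt := fits_bitlen (tmp_addr_fits (isT : (0 < 1000)%N)).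
    have ba := fits_bitlen (eval_fits hs (shallow_typed ht)).
    by rewrite /= v1 /unit_cost; lia.
  rewrite /= v1 addn1 addnS; split=> //.
  by case: rep1 => /= ? ? ? ->; split.
- case/andP: ht => hta htb; case/code_at_cat: hc; rewrite size_compile => ha hb.
  have [c1 r1 [rep1 e1]] := IHa s k _ hta ha hs rep erefl.
  have [c2 r2 [rep2 e2]] := IHb _ _ _ htb hb (bounded_sem hta hs) rep1 e1.
  by exists c2; [exact: reach_trans r1 r2 | rewrite e2 addnA].
- case/andP: ht => ht hb; case/code_at_cat: hc => h1 h2.
  have [m1 r1 rep1] := test_code_correct hs ht h1 rep.
  move: h2; rewrite size_cat /= addnA => h2.
  case: ifP r1 rep1 => hold r1 rep1; last first.
    exists (Config (k + size (compile_expr 0 (test_expr t)) + 2 + length_of b)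
              m1 w o); last by rewrite !addnA.
    exact: reach_weaken (leq_addr _ _) r1.
  rewrite addnA in r1 rep1.
  case/orP: hb => hb.
    have [c2 r2 [rep2 e2]] := IHb s _ _ hb h2 hs rep1 erefl.
    by exists c2; [exact: reach_trans r1 r2 | rewrite e2 !addnA].
  have [e [c [et eb hv _ hi]]] := capped_incrP hb.
  rewrite eb in h2 *.
  have [m2 r2 rep2] := assign_code_correct hs hv hi h2 rep1.
  exists (Config (k + size (compile_expr 0 (test_expr t)) + 2 +
                  size (assign_code c (incr c))) m2 w o).
    exact: reach_trans r1 r2.
  by rewrite /= !addnA.
- case/and5P: ht => hi hn hd hless /and5P[hincr hzero hib hnb]
    /andP[hin hb].
  case/code_at_cat: hc => h1 /code_at_cat[h2 /code_at_cat[h3 /code_at_cat[h4]]].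
  move=> /code_at_cons[h5 _].
  rewrite size_cat /= in h3 h4 h5; rewrite size_compile in h4 h5.
  set k1 := (k + size (assign_code i (Num 0)))%N in h1 h2 h3 h4 h5.
  set lt := (size (compile_expr 0 (Bin Defs.Sub (Var n) (Var i))) + 2)%N
    in h2 h3 h4 h5 *.
  set k2 := (k1 + lt)%N in h2 h3 h4 h5.
  set li := size (assign_code i (incr i)) in h2 h4 h5 *.
  set k3 := (k2 + length_of b + li + 1)%N in h2.
  have [m1 r1 rep1] := assign_code_correct hs hi hzero h1 rep.
  rewrite -/k1 in r1 rep1; set N := trips (vars s n).
  pose st j := iteri j (fun k s' => sem b (set_var i k%:Z s')) s.
  have leN : (N <= S ^ (gamma n).1)%N.
    case: hs => /(_ n); rewrite /bound (eqP hn) muln0 muln1 => hvn _ _.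
    by apply: leq_trans hvn; rewrite /N /trips; case: ifP.
  have hin_sym : n != i by rewrite eq_sym.
  have bst j : (j <= N)%N -> bounded (st j).
    elim: j => // j IHj hj; apply: bounded_sem => //.
    apply: bounded_set_var; last exact: IHj (ltnW hj).
    exact: loop_index_bounded hd hs (ltnW hj).
  have stn j : vars (st j) n = vars s n.
    by elim: j => //= j IHj; rewrite sem_frame //= eq_sym (negPf hin).
  (* Induction on the number r of rounds that are left. *)
  have loop r : forall cfg, (r <= N)%N ->
      represents (set_var i (N - r)%N%:Z (st (N - r)%N)) cfg -> pc cfg = k1 ->
      exists2 cfg', reach cfg (r * (lt + step_bound b + li + 1) + lt) cfg'
        & represents (set_var i N%:Z (st N)) cfg' /\ pc cfg' = k3.
    elim: r => [|r IHr] [k' m' w' o'] hr rep' /= e'; subst k'.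
      have bN : bounded (set_var i N%:Z (st N)).
        by apply: bounded_set_var (bst _ _) => //; exact: loop_index_bounded hd hs _.
      rewrite subn0 in rep'; have [m2] := test_code_correct bN hless h2 rep'.
      rewrite /= eqxx (negPf hin_sym) stn ifF; last first.
        by rewrite -ltn_trips ltnn.
      by move=> r2 rep2; exists (Config k3 m2 w' o').
    set j := (N - r.+1)%N in rep'.
    have hj : (j < N)%N by rewrite /j ltn_subrL (leq_ltn_trans _ hr).
    have bj : bounded (set_var i j%:Z (st j)).
      apply: bounded_set_var (bst _ (ltnW hj)) => //.
      exact: loop_index_bounded hd hs (ltnW hj).
    have [m2] := test_code_correct bj hless h2 rep'.
    rewrite /= eqxx (negPf hin_sym) stn ifT; last first.
      by rewrite -ltn_trips.
    rewrite -/lt -/k2 => r2 rep2.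
    have [[k4 m4 w4 o4] r4 [rep4 /= e4]] := IHb _ _ _ hb h3 bj rep2 erefl.
    subst k4; rewrite -[sem b _]/(st j.+1) in rep4.
    have [m5] := assign_code_correct (bst _ hj) hi hincr h4 rep4.
    have -> : eval (st j.+1) (incr i) = j.+1%:Z.
      by rewrite /= sem_frame //= eqxx -[j.+1]addn1 PoszD.
    rewrite -/li => r5 rep5.
    have r6 : reach (Config (k2 + length_of b + li) m5 w4 o4) 1
                (Config k1 m5 w4 o4).
      by apply: reach1 h5 _; rewrite /= muln_gt0.
    have rj : (N - r)%N = j.+1 by rewrite /j subnSK.
    have [|cfg' r7 [rep7 e7]] :=
      IHr (Config k1 m5 w4 o4) (ltnW hr) _ erefl.
      by rewrite rj; exact: represents_pc rep5.
    exists cfg' => //; apply: reach_weaken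
      (reach_trans r2 (reach_trans r4 (reach_trans r5 (reach_trans r6 r7)))).
    by rewrite mulSn -/lt; clear; lia.
  have [|cfg' r2 [rep2 e2]] :=
    loop N (Config k1 m1 w o) (leqnn _) _ erefl.
    by rewrite subnn; exact: rep1.
  exists cfg'; last first.
    by split=> //; rewrite e2 /k3 /k2 /k1 -/lt -/li !addnA.
  apply: reach_weaken (reach_trans r1 r2).
  by rewrite -/lt -/li -addnA leq_add2l leq_add2r leq_mul2r leN orbT.
Qed.

End Simulation.
End StaticBounds.

(** Closure properties are easier to apply to functions than to {poly nat}. *)
Definition polynomial (f : nat -> nat) : Prop :=
  exists q : {poly nat}, forall x, f x = q.[x].

Lemma polynomial_const k : polynomial (fun=> k).
Proof. by exists (k%:P) => x; rewrite hornerC. Qed.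

Lemma polynomial_shift k : polynomial (fun x => x + k)%N.
Proof. by exists ('X + k%:P) => x; rewrite hornerD hornerX hornerC. Qed.

Lemma polynomial_add f g :
  polynomial f -> polynomial g -> polynomial (fun x => f x + g x)%N.
Proof.
by move=> [p hp] [q hq]; exists (p + q) => x; rewrite hornerD hp hq.
Qed.

Lemma polynomial_mul f g :
  polynomial f -> polynomial g -> polynomial (fun x => f x * g x)%N.
Proof.
by move=> [p hp] [q hq]; exists (p * q) => x; rewrite hornerM hp hq.
Qed.

Lemma polynomial_exp f k : polynomial f -> polynomial (fun x => f x ^ k)%N.
Proof.
move=> hf; elim: k => [|k IHk]; first exact: polynomial_const.
have [q hq] := polynomial_mul hf IHk.
by exists q => x; rewrite -hq expnS.
Qed.

Lemma step_bound_polynomial gamma c k :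
  polynomial (fun x => step_bound gamma (x + k) c).
Proof.
elim: c => [v e|c e1 e2|v|e|a IHa b IHb|t b IHb|i n b IHb] /=;
  do ![exact: polynomial_const | exact: polynomial_shift
      | apply: polynomial_add | apply: polynomial_mul
      | apply: polynomial_exp | by []].
Qed.

(** * Loops that search for a witness *)

Lemma sem_seq a b s : sem (Seq a b) s = sem b (sem a s).
Proof. by []. Qed.

Lemma sem_if t b s : sem (If t b) s = if holds s t then sem b s else s.
Proof. by []. Qed.

Lemma trips_nat n : trips n%:Z = n.
Proof. by rewrite /trips; case: n. Qed.

Lemma sem_for_inv (Inv : nat -> state -> Prop) i n b s N :
  trips (vars s n) = N -> Inv 0%N s ->
  (forall k s', (k < N)%N -> Inv k s' ->
    Inv k.+1 (sem b (set_var i k%:Z s'))) ->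
  exists2 s', sem (For i n b) s = set_var i N%:Z s' & Inv N s'.
Proof.
move=> hN h0 hS; rewrite /= hN; eexists; first by [].
have: (N <= N)%N by [].
elim: {1 3 4}N => //= k IHk hk; apply: hS => //; exact: IHk (ltnW hk).
Qed.

Fixpoint free_vars (e : expr) : seq nat :=
  match e with
  | Num _ => [::]
  | Var v => [:: v]
  | Arr _ e => free_vars e
  | Bin _ a b => free_vars a ++ free_vars b
  end.

(** A search only clobbers its flag and its indices, and its outcome depends on
    neither; both facts are instances of this relation. *)
Definition agree (V : seq nat) (s s' : state) : Prop :=
  [/\ forall v, v \notin V -> vars s v = vars s' v, arrs s = arrs s',
      sinp s = sinp s' & sout s = sout s'].

Lemma agree_refl V s : agree V s s.
Proof. by []. Qed.

Lemma agree_trans V s1 s2 s3 : agree V s1 s2 -> agree V s2 s3 -> agree V s1 s3.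
Proof.
case=> h1 a1 i1 o1 [h2 a2 i2 o2]; split; try congruence.
by move=> v hv; rewrite h1 // h2.
Qed.

Lemma agree_sub V V' s s' : {subset V <= V'} -> agree V s s' -> agree V' s s'.
Proof. by move=> hV [h ? ? ?]; split=> // v hv; apply/h/(contra (hV v)). Qed.

Lemma agree_set_var V i a s s' :
  agree (i :: V) s s' -> agree V (set_var i a s) (set_var i a s').
Proof.
move=> [h ? ? ?]; split=> // v hv /=; case: eqP => // /eqP vi.
by apply: h; rewrite inE (negPf vi).
Qed.

Lemma agree_set_var_r V i a s : i \in V -> agree V s (set_var i a s).
Proof. by move=> hi; split=> // v hv /=; case: eqP hv => // ->; rewrite hi. Qed.

Lemma eval_agree V s s' e :
  agree V s s' -> ~~ has (mem V) (free_vars e) -> eval s e = eval s' e.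
Proof.
case=> hv ha _ _; elim: e => [a|v|c e IHe|op a IHa b IHb] //=.
- by rewrite orbF => /hv.
- by move=> /IHe ->; rewrite ha.
- by rewrite has_cat negb_or => /andP[/IHa -> /IHb ->].
Qed.

(** All exhaustive searches of the algorithm have this form: nested loops that
    set a flag when all tests succeed. *)
Definition mark (flag : nat) (ls : seq (nat * nat)) (ts : seq test) : cmd :=
  foldr (fun l c => For l.1 l.2 c) (foldr If (Asg flag (Num 1)) ts) ls.

Fixpoint any (ls : seq (nat * nat)) (ts : seq test) (s : state) : bool :=
  if ls is l :: r then
    has (fun k => any r ts (set_var l.1 k%:Z s)) (iota 0 (trips (vars s l.2)))
  else all (holds s) ts.

(** The flag is only written, and the bounds of the loops depend on none of the
    variables that the search changes: rounds do not influence each other. *)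
Definition well_scoped (flag : nat) (ls : seq (nat * nat)) (ts : seq test) :=
  [&& flag \notin unzip1 ls, all (fun l => l.2 \notin flag :: unzip1 ls) ls
    & all (fun t => flag \notin free_vars (test_expr t)) ts].

Lemma well_scoped_behead flag l ls ts :
  well_scoped flag (l :: ls) ts -> well_scoped flag ls ts.
Proof.
rewrite /well_scoped /= inE negb_or -!andbA => /and5P[_ -> _ h ->].
rewrite andbT /=; apply: sub_all h => v; rewrite !inE !negb_or.
by case/and3P=> -> _ ->.
Qed.

Lemma any_agree flag ls ts s s' : well_scoped flag ls ts ->
  agree (flag :: unzip1 ls) s s' -> any ls ts s = any ls ts s'.
Proof.
elim: ls s s' => [|l ls IHls] s s' hws hs.
  case/and3P: hws => _ _ /=; elim: ts => //= t ts IHts /andP[ht /IHts ->].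
  congr (_ && _); case: t ht => e /= he;
    by rewrite (eval_agree hs) // has_sym /= orbF.
have hws' := well_scoped_behead hws.
rewrite /=; have -> : vars s l.2 = vars s' l.2.
  by case: hs => h _ _ _; apply: h; case/and3P: hws => _ /= /andP[].
apply: eq_in_has => k _; apply: IHls => //; apply: agree_set_var.
by apply: agree_sub hs => v; rewrite /= !inE orbCA.
Qed.

Lemma mark_sem flag ls ts s : well_scoped flag ls ts ->
  agree (flag :: unzip1 ls) s (sem (mark flag ls ts) s) /\
  vars (sem (mark flag ls ts) s) flag =
    if any ls ts s then 1 else vars s flag.
Proof.
elim: ls s => [|[i n] ls IHls] s hws.
  rewrite /= /mark /=; elim: ts {hws} => [|t ts IHts] /=.
    rewrite eqxx; split=> //; apply: agree_set_var_r; exact: mem_head.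
  by rewrite -[(foldr _ _ _)]/(mark flag [::] ts); case: (holds s t).
have hws' := well_scoped_behead hws.
have [hfi hfl] : flag != i /\ flag \notin unzip1 ls.
  by apply/andP; rewrite -negb_or -in_cons; case/and3P: hws.
change (mark flag ((i, n) :: ls) ts) with (For i n (mark flag ls ts)).
pose Inv k s' := agree (flag :: i :: unzip1 ls) s s' /\
  vars s' flag = if has (fun k => any ls ts (set_var i k%:Z s)) (iota 0 k)
                 then 1 else vars s flag.
have [| |s' -> [ag hf]] := @sem_for_inv Inv i n (mark flag ls ts) s _ erefl.
- by split=> //; apply: agree_refl.
- move=> k s1 _ [ag1 hf1]; have [ag2 hf2] := IHls (set_var i k%:Z s1) hws'.
  split.
    apply: (agree_trans ag1); apply: agree_trans (agree_sub _ ag2).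
      by apply: agree_set_var_r; rewrite !inE eqxx orbT.
    by move=> v; rewrite !inE => /orP[->|->] //; rewrite !orbT.
  rewrite hf2 -addn1 iotaD has_cat /= orbF add0n.
  have -> : any ls ts (set_var i k%:Z s1) = any ls ts (set_var i k%:Z s).
    apply: (any_agree hws'); apply: agree_set_var.
    case: ag1 => h ? ? ?; split=> // v; rewrite inE => hv.
    by rewrite h // !inE orbCA -in_cons.
  by rewrite (negPf hfi) hf1 orbC; case: (any _ _ _).
split; last by rewrite /= (negPf hfi).
by apply: agree_trans ag _; apply: agree_set_var_r; rewrite !inE eqxx orbT.
Qed.

(** * The algorithm *)

Local Notation nX := 0%N (only parsing).
Local Notation nZ := 1%N (only parsing).
Local Notation cap := 2%N (only parsing).
Local Notation iX := 3%N (only parsing).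
Local Notation jX := 4%N (only parsing).
Local Notation kZ := 5%N (only parsing).
Local Notation lZ := 6%N (only parsing).
Local Notation dist := 7%N (only parsing).
Local Notation flag := 8%N (only parsing).
Local Notation vKn := 9%N (only parsing).
Local Notation vKd := 10%N (only parsing).
Local Notation cnt := 11%N (only parsing).
Local Notation buf := 12%N (only parsing).

Local Notation aX := 0%N (only parsing).
Local Notation aPn := 1%N (only parsing).
Local Notation aPd := 2%N (only parsing).
Local Notation aZ := 3%N (only parsing).
Local Notation aQn := 4%N (only parsing).
Local Notation aQd := 5%N (only parsing).
Local Notation aT := 6%N (only parsing).

Local Notation cell a i := (Arr a (Var i)) (only parsing).
Local Infix "[+]" := (Bin Add) (at level 50, left associativity).
Local Infix "[-]" := (Bin Defs.Sub) (at level 50, left associativity).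
Local Infix "[*]" := (Bin Mul) (at level 40, left associativity).
Local Infix ";;" := Seq (at level 90, right associativity).

Definition read_into (a i : nat) : cmd := Input buf ;; Store a (Var i) (Var buf).

Definition read_table (a i n : nat) : cmd :=
  For i n (read_into a i ;; read_into a.+1 i ;; read_into a.+2 i).

(** Moves avoid all other inputs, wherever these are in the list, so every place
    has to be known before the first move. *)
Definition init_T : cmd := For iX nX (Store aT (Var iX) (cell aX iX)).

Definition gap : expr := (cell aX iX) [-] (cell aX jX).

(** These tests decide [costly] with integers. The weight of (x_i, z_k) has the
    factor p x_i in common with the price of moving x_i, which is why the third
    test does not mention p. *)
Definition bad_tests : seq test :=
  [:: Zero ((cell aX iX) [+] (cell aZ kZ) [-] ((cell aX jX) [+] (cell aZ lZ)));
      Pos ((cell aPn jX) [*] (cell aPd iX) [-] (cell aPn iX) [*] (cell aPd jX) [+] Num 1);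
      Pos (Var vKn [*] (cell aQn kZ) [*] gap [*] gap [-]
           Num 2 [*] Var vKd [*] (cell aQd kZ));
      Pos (Var vKn [*] (cell aPn jX) [*] (cell aQn lZ) [*] gap [*] gap [*]
           (cell aPd iX) [-]
           Num 2 [*] (cell aPn iX) [*] Var vKd [*] (cell aPd jX) [*] (cell aQd lZ))].

Definition clash_tests : seq test :=
  [:: Pos ((Var iX [-] Var jX) [*] (Var iX [-] Var jX));
      Zero ((cell aT iX) [+] (cell aZ kZ) [-] ((cell aT jX) [+] (cell aZ lZ)))].

Definition triples : seq (nat * nat) := [:: (jX, nX); (kZ, nZ); (lZ, nZ)].

Definition detect (ts : seq test) : cmd :=
  Asg flag (Num 0) ;; mark flag triples ts.

(** The search for a free place runs over all distances up to the cap, so that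
    the distance is a loop index and has a degree; once the place is free, the
    remaining rounds change nothing. *)
Definition relocate : cmd :=
  For dist cap (detect clash_tests ;;
    If (Pos (Var flag))
      (Store aT (Var iX) ((cell aX iX) [+] (Var dist [+] Num 1)))).

Definition place : cmd :=
  For iX nX (detect bad_tests ;; If (Pos (Var flag)) relocate).

Definition same_obs : test :=
  Zero ((cell aT jX) [+] (cell aZ lZ) [-] ((cell aT iX) [+] (cell aZ kZ))).

Definition weight_diff : expr :=
  (cell aPn jX) [*] (cell aQn lZ) [*] (cell aPd iX) [*] (cell aQd kZ) [-]
  (cell aPn iX) [*] (cell aQn kZ) [*] (cell aPd jX) [*] (cell aQd lZ).

Definition pairs : seq (nat * nat) := [:: (jX, nX); (lZ, nZ)].

Definition heavier : seq test := [:: same_obs; Pos weight_diff].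
Definition tie : seq test :=
  [:: same_obs; Zero weight_diff; Pos ((cell aZ kZ) [-] (cell aZ lZ))].

(** A pair is beaten if a heavier pair has the same observation, or an equally
    heavy one with a smaller z. Once T is injective this is a strict total order
    on the pairs with a given observation, so each observation has exactly one
    unbeaten pair and is listed exactly once. *)
Definition contest : cmd :=
  Asg flag (Num 0) ;; mark flag pairs heavier ;; mark flag pairs tie.

Definition for_winners (c : cmd) : cmd :=
  For iX nX (For kZ nZ (contest ;; If (Zero (Var flag)) c)).

(** The guard never fails; it gives the counter its degree. *)
Definition count_one : cmd :=
  If (Pos (Var nX [*] Var nZ [-] Var cnt)) (Asg cnt (incr cnt)).

Definition emit_one : cmd :=
  Output ((cell aT iX) [+] (cell aZ kZ)) ;; Output (Num 0 [-] (cell aT iX)).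

Definition main : cmd :=
  Input vKn ;; Input vKd ;;
  Asg cap ((Var nX [-] Num 1) [*] Var nZ [*] Var nZ) ;;
  init_T ;;
  place ;;
  Output (Var nX) ;;
  For iX nX (Output (cell aX iX) ;; Output (cell aT iX)) ;;
  Asg cnt (Num 0) ;;
  for_winners count_one ;;
  Output (Var cnt) ;;
  for_winners emit_one.

Definition algorithm : cmd :=
  Input nX ;; read_table aX iX nX ;; Input nZ ;; read_table aZ kZ nZ ;; main.

Definition machine : program := compile 0 algorithm.

(** * Degrees of the variables *)

(** The lengths of the two lists have the degree of an arbitrary input while
    they have not been read. *)
Definition var_degree (dX dZ : degree) (v : nat) : degree :=
  nth (0, 0)%N
    [:: dX; dZ; (4, 0); (1, 0); (1, 0); (1, 0); (1, 0); (4, 0); (1, 0);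
        (0, 1); (0, 1); (2, 0); (0, 1)]%N v.

Definition arr_degree (a : nat) : degree :=
  nth (0, 0)%N [:: (0, 1); (0, 1); (0, 1); (0, 1); (0, 1); (0, 1); (6, 1)]%N a.

Definition small : degree := (1, 0)%N.
Definition large : degree := (0, 1)%N.

Lemma typed_read_nX : typed (var_degree large large) arr_degree 40 (Input nX).
Proof. by []. Qed.

Lemma typed_read_X : typed (var_degree small large) arr_degree 40
  (read_table aX iX nX).
Proof. by vm_compute. Qed.

Lemma typed_read_nZ : typed (var_degree small large) arr_degree 40 (Input nZ).
Proof. by []. Qed.

Lemma typed_rest :
  typed (var_degree small small) arr_degree 40 (read_table aZ kZ nZ ;; main).
Proof. by vm_compute. Qed.

Lemma scoped_bad : well_scoped flag triples bad_tests.
Proof. by []. Qed.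
Lemma scoped_clash : well_scoped flag triples clash_tests.
Proof. by []. Qed.
Lemma scoped_heavier : well_scoped flag pairs heavier.
Proof. by []. Qed.
Lemma scoped_tie : well_scoped flag pairs tie.
Proof. by []. Qed.

(** * Reading the input *)

Definition loaded (s : state) (a : nat) (l : seq int) (f : int -> rat) : Prop :=
  forall i, (i < size l)%N ->
    [/\ arrs s a i%:Z = l`_i, arrs s a.+1 i%:Z = numq (f l`_i)
      & arrs s a.+2 i%:Z = denq (f l`_i)].

Definition rows (l : seq int) (f : int -> rat) : seq int :=
  flatten [seq x :: enc_rat (f x) | x <- l].

Lemma read_table_sem a i n l f rest s :
  i != buf -> n != buf -> n != i -> vars s n = (size l)%:Z ->
  sinp s = rows l f ++ rest ->
  let s' := sem (read_table a i n) s in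
  [/\ loaded s' a l f, sinp s' = rest, sout s' = sout s,
      forall v, v \notin [:: i; buf] -> vars s' v = vars s v
    & forall c, c \notin [:: a; a.+1; a.+2] -> arrs s' c = arrs s c].
Proof.
move=> hi hnb hni hn hin; rewrite /read_table.
pose Inv k s' := [/\ forall j, (j < k)%N -> [/\ arrs s' a j%:Z = l`_j,
      arrs s' a.+1 j%:Z = numq (f l`_j) & arrs s' a.+2 j%:Z = denq (f l`_j)],
    sinp s' = rows (drop k l) f ++ rest, sout s' = sout s,
    forall v, v \notin [:: i; buf] -> vars s' v = vars s v
  & forall c, c \notin [:: a; a.+1; a.+2] -> arrs s' c = arrs s c].
have hN : trips (vars s n) = size l by rewrite hn trips_nat.
have [|k s1 hk [h1 h2 h3 h4 h5]|s1 -> [h1 h2 h3 h4 h5]] :=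
  @sem_for_inv Inv i n (read_into a i ;; read_into a.+1 i ;; read_into a.+2 i)
    s _ hN.
- by split=> //; rewrite drop0.
- rewrite (drop_nth 0 hk) /= in h2; split=> /=.
  + move=> j; rewrite ltnS leq_eqVlt /= !eqxx (negPf hi).
    have -> : (a == a.+1) = false by lia.
    have -> : (a == a.+2) = false by lia.
    have -> : (a.+1 == a) = false by lia.
    have -> : (a.+1 == a.+2) = false by lia.
    have -> : (a.+2 == a) = false by lia.
    have -> : (a.+2 == a.+1) = false by lia.
    rewrite h2 /= eqz_nat; case: eqP => [->|_] //= hj.
    exact: h1.
  + by rewrite h2.
  + exact: h3.
  + move=> v hv; rewrite -h4 //; move: hv; rewrite !inE negb_or.
    by case/andP=> /negPf -> /negPf ->.
  + move=> c hc; rewrite -h5 //; move: hc; rewrite !inE !negb_or.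
    by case/and3P=> /negPf -> /negPf -> /negPf ->.
split=> //; first by rewrite /= h2 drop_size.
move=> v; rewrite !inE negb_or => /andP[/negPf e hb].
by rewrite /= e h4 // !inE e.
Qed.

(** * Meaning of the tests *)

Lemma numqE_div (a : rat) : a = (numq a)%:~R / (denq a)%:~R.
Proof. by rewrite divq_num_den. Qed.

Lemma ltr_cross (a b c d : int) : 0 < b -> 0 < d ->
  (a%:~R / b%:~R < c%:~R / d%:~R :> rat) = (0 < c * b - a * d).
Proof.
move=> b0 d0; have b0' : 0 < b%:~R :> rat by rewrite ltr0z.
have d0' : 0 < d%:~R :> rat by rewrite ltr0z.
by rewrite ltr_pdivrMr // mulrAC ltr_pdivlMr // -!intrM ltr_int subr_gt0.
Qed.

Lemma eqr_cross (a b c d : int) : 0 < b -> 0 < d ->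
  (a%:~R / b%:~R == c%:~R / d%:~R :> rat) = (a * d - c * b == 0).
Proof.
move=> b0 d0; have b0' : 0 < b%:~R :> rat by rewrite ltr0z.
have d0' : 0 < d%:~R :> rat by rewrite ltr0z.
by rewrite eqr_div ?(gt_eqF b0') ?(gt_eqF d0') // -!intrM eqr_int subr_eq0.
Qed.

Lemma has_iota_nth (P : pred int) (l : seq int) :
  has (fun k => P l`_k) (iota 0 (size l)) = has P l.
Proof. by rewrite -{3}[l](mkseq_nth 0) has_map. Qed.

Section Run.

Variables (sX sZ : seq int) (p q : int -> rat) (K : rat).

Local Notation n := (size sX).
Local Notation m := (size sZ).

Definition ready (s : state) : Prop :=
  [/\ [/\ vars s nX = n%:Z, vars s nZ = m%:Z, vars s vKn = numq K
        & vars s vKd = denq K],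
      loaded s aX sX p & loaded s aZ sZ q].

Lemma ready_agree V s s' :
  agree V s s' -> ~~ has (mem V) [:: nX; nZ; vKn; vKd] -> ready s -> ready s'.
Proof.
case=> hv ha _ _; rewrite /= !negb_or => /and5P[h0 h1 h2 h3 _].
by case=> -[e0 e1 e2 e3] ldX lZ; split; rewrite /loaded -?hv -?ha.
Qed.

Definition outweighs (x z x' z' : int) : bool := p x * q z < p x' * q z'.

(** Moving x or x' costs at least p x, and leaving both where they are costs at
    least half of K w (x - x')^2, w being the smaller of the two probabilities
    p x * q z and p x' * q z'; so every policy pays at least p x. The
    inequality for p x * q z is divided by p x. *)
Definition costly (x x' z z' : int) : bool :=
  [&& x + z == x' + z', p x <= p x', 2 < K * q z * (x - x')%:~R ^+ 2
    & 2 * p x < K * (p x' * q z') * (x - x')%:~R ^+ 2].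

Definition bad (x : int) : bool :=
  has (fun x' => has (fun z => has (costly x x' z) sZ) sZ) sX.

Definition clash (t : nat -> int) (i : nat) : bool :=
  has (fun j => has (fun k => has (fun l =>
      (i != j) && (t i + sZ`_k == t j + sZ`_l))
    (iota 0 m)) (iota 0 m)) (iota 0 n).

Definition beats (t : nat -> int) (i k j l : nat) : bool :=
  (t j + sZ`_l == t i + sZ`_k) &&
  (outweighs sX`_i sZ`_k sX`_j sZ`_l ||
   ((p sX`_j * q sZ`_l == p sX`_i * q sZ`_k) && (sZ`_l < sZ`_k))).

Definition beaten (t : nat -> int) (i k : nat) : bool :=
  has (fun j => has (beats t i k j) (iota 0 m)) (iota 0 n).

Lemma eq_has_iota (P Q : pred nat) N :
  (forall k, (k < N)%N -> P k = Q k) -> has P (iota 0 N) = has Q (iota 0 N).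
Proof. by move=> h; apply: eq_in_has => k; rewrite mem_iota => /h. Qed.

Lemma any_bad s i : ready s -> (i < n)%N -> vars s iX = i%:Z ->
  any triples bad_tests s = bad sX`_i.
Proof.
move=> [[en em eKn eKd] ldX ldZ] hi ei.
have [x1 x2 x3] := ldX _ hi.
rewrite /bad -has_iota_nth /triples [LHS]/= en trips_nat.
apply: eq_has_iota => j hj; rewrite -has_iota_nth /= em trips_nat.
have [y1 y2 y3] := ldX _ hj.
apply: eq_has_iota => k hk; rewrite -has_iota_nth.
have [z1 z2 z3] := ldZ _ hk.
apply: eq_has_iota => l hl; have [u1 u2 u3] := ldZ _ hl.
rewrite /costly /= ei eKn eKd x1 x2 x3 y1 y2 y3 z1 z2 z3 u1 u2 u3 andbT.
set x := sX`_i; set x' := sX`_j; set z := sZ`_k; set z' := sZ`_l.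
congr [&& _, _, _ & _].
- by rewrite subr_eq0.
- rewrite leNgt [p x' < _](_ : _ = (0 < numq (p x) * denq (p x') -
    numq (p x') * denq (p x))); last first.
    by rewrite {1}[p x]numqE_div {1}[p x']numqE_div ltr_cross ?denq_gt0.
  by move: (_ * _) (_ * _); lia.
- have -> : 2 = (2 : int)%:~R / (1 : int)%:~R :> rat by rewrite divr1.
  have -> : K * q z * (x - x')%:~R ^+ 2 =
      (numq K * numq (q z) * (x - x') * (x - x'))%:~R /
      (denq K * denq (q z))%:~R.
    rewrite {1}[K]numqE_div {1}[q z]numqE_div !intrM.
    by field; rewrite !intr_eq0 !denq_neq0.
  rewrite ltr_cross ?mulr_gt0 ?denq_gt0 //; congr (0 < _); ring.
- have -> : 2 * p x = (2 * numq (p x))%:~R / (denq (p x))%:~R.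
    by rewrite {1}[p x]numqE_div intrM mulrA.
  have -> : K * (p x' * q z') * (x - x')%:~R ^+ 2 =
      (numq K * numq (p x') * numq (q z') * (x - x') * (x - x'))%:~R /
      (denq K * denq (p x') * denq (q z'))%:~R.
    rewrite {1}[K]numqE_div {1}[p x']numqE_div {1}[q z']numqE_div !intrM.
    by field; rewrite !intr_eq0 !denq_neq0.
  rewrite ltr_cross ?mulr_gt0 ?denq_gt0 //; congr (0 < _); ring.
Qed.

Lemma any_clash s t i : ready s -> (i < n)%N -> vars s iX = i%:Z ->
  (forall j, (j < n)%N -> arrs s aT j%:Z = t j) ->
  any triples clash_tests s = clash t i.
Proof.
move=> [[en em _ _] ldX ldZ] hi ei hT.
rewrite /clash /triples [LHS]/= en trips_nat.
apply: eq_has_iota => j hj; rewrite /= em trips_nat.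
apply: eq_has_iota => k hk.
have [z1 _ _] := ldZ _ hk.
apply: eq_has_iota => l hl; have [u1 _ _] := ldZ _ hl.
rewrite /= ei !hT // z1 u1 andbT subr_eq0; congr (_ && _).
by rewrite -expr2 lt0r sqr_ge0 andbT sqrf_eq0 subr_eq0.
Qed.

Lemma weight_diffE s i j k l : ready s ->
  (i < n)%N -> vars s iX = i%:Z -> (j < n)%N -> vars s jX = j%:Z ->
  (k < m)%N -> vars s kZ = k%:Z -> (l < m)%N -> vars s lZ = l%:Z ->
  ((0 < eval s weight_diff) = outweighs sX`_i sZ`_k sX`_j sZ`_l) *
  ((eval s weight_diff == 0) =
   (p sX`_j * q sZ`_l == p sX`_i * q sZ`_k)).
Proof.
move=> [_ ldX ldZ] hi ei hj ej hk ek hl el.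
have [x1 x2 x3] := ldX _ hi; have [y1 y2 y3] := ldX _ hj.
have [z1 z2 z3] := ldZ _ hk; have [u1 u2 u3] := ldZ _ hl.
rewrite /outweighs /= ei ej ek el x2 x3 y2 y3 z2 z3 u2 u3.
have frac x z : p x * q z =
    (numq (p x) * numq (q z))%:~R / (denq (p x) * denq (q z))%:~R.
  rewrite {1}[p x]numqE_div {1}[q z]numqE_div !intrM.
  by field; rewrite !intr_eq0 !denq_neq0.
rewrite !frac ltr_cross ?eqr_cross ?mulr_gt0 ?denq_gt0 //.
by split; [congr (0 < _)|congr (_ == 0)]; ring.
Qed.

Lemma any_contest s t i k : ready s ->
  (i < n)%N -> vars s iX = i%:Z -> (k < m)%N -> vars s kZ = k%:Z ->
  (forall j, (j < n)%N -> arrs s aT j%:Z = t j) ->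
  any pairs heavier s || any pairs tie s = beaten t i k.
Proof.
move=> hs hi ei hk ek hT.
have [[en em _ _] _ ldZ] := hs; have [z1 _ _] := ldZ _ hk.
rewrite /pairs /heavier /tie /beaten [LHS]/= en trips_nat -has_predU.
apply: eq_has_iota => j hj; rewrite /= em trips_nat -has_predU.
apply: eq_has_iota => l hl; have [u1 _ _] := ldZ _ hl.
pose s' := set_var lZ l%:Z (set_var jX j%:Z s).
have hs' : ready s' by [].
have [w1 w2] := @weight_diffE s' i j k l hs' hi ei hj erefl hk ek hl erefl.
rewrite -/s' /beats [predU _ _ _]/= /holds w1 w2 /= ei ek !hT // z1 u1 !andbT.
by rewrite subr_eq0 subr_gt0; case: (_ == _).
Qed.

(** * Moving the inputs *)

Lemma detect_sem ts s : well_scoped flag triples ts ->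
  agree [:: flag; jX; kZ; lZ] s (sem (detect ts) s) /\
  vars (sem (detect ts) s) flag = if any triples ts s then 1 else 0.
Proof.
move=> hws; rewrite /detect sem_seq.
have [ag ->] := mark_sem (sem (Asg flag (Num 0)) s) hws.
have ag0 : agree [:: flag; jX; kZ; lZ] s (sem (Asg flag (Num 0)) s).
  by apply: agree_set_var_r; apply: mem_head.
by split; [exact: agree_trans ag0 ag | rewrite -(any_agree hws ag0)].
Qed.

(** Unlike [agree], this lets the array T change. *)
Definition keeps (V : seq nat) (s s' : state) : Prop :=
  [/\ forall v, v \notin V -> vars s' v = vars s v,
      forall c, c != aT -> arrs s' c = arrs s c,
      sinp s' = sinp s & sout s' = sout s].

Lemma keeps_refl V s : keeps V s s.
Proof. by []. Qed.

Lemma agree_keeps V V' s s' :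
  {subset V <= V'} -> agree V s s' -> keeps V' s s'.
Proof.
move=> hV [hv ha hi ho]; split=> // [v hvV|c _]; last by rewrite ha.
by rewrite -hv //; apply: contra (hV v) hvV.
Qed.

Lemma keeps_trans V V' s1 s2 s3 : {subset V <= V'} ->
  keeps V' s1 s2 -> keeps V s2 s3 -> keeps V' s1 s3.
Proof.
move=> hV [h1 a1 i1 o1] [h2 a2 i2 o2]; split; try congruence.
  by move=> v hv; rewrite h2 ?h1 //; apply: contra (hV v) hv.
by move=> c hc; rewrite a2 // a1.
Qed.

Lemma keeps_set_var_trans V s1 s2 v a :
  keeps V s1 s2 -> v \in V -> keeps V s1 (set_var v a s2).
Proof.
case=> h1 a1 i1 o1 hv; split=> // u hu /=.
by case: eqP hu => [->|_]; [rewrite hv | apply: h1].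
Qed.

Lemma keeps_set_arr_trans V s1 s2 i a :
  keeps V s1 s2 -> keeps V s1 (set_arr aT i a s2).
Proof. by case=> h1 a1 i1 o1; split=> // c hc /=; rewrite (negPf hc) a1. Qed.

Lemma ready_keeps V s s' :
  keeps V s s' -> ~~ has (mem V) [:: nX; nZ; vKn; vKd] -> ready s -> ready s'.
Proof.
case=> hv ha _ _; rewrite /= !negb_or => /and5P[h0 h1 h2 h3 _].
by case=> -[e0 e1 e2 e3] ldX ldZ; split; rewrite /loaded ?hv ?ha.
Qed.

Definition tabs (s : state) (t : nat -> int) : Prop :=
  forall j, (j < n)%N -> arrs s aT j%:Z = t j.

Definition upd (t : nat -> int) (i : nat) (a : int) : nat -> int :=
  fun j => if j == i then a else t j.

Lemma clashPn t i : reflect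
  (forall j k l, (j < n)%N -> (k < m)%N -> (l < m)%N -> i != j ->
     t i + sZ`_k != t j + sZ`_l) (~~ clash t i).
Proof.
apply: (iffP hasPn) => [h j k l hj hk hl ij|h j].
  have /h/hasPn/(_ k) : j \in iota 0 n by rewrite mem_iota.
  by rewrite mem_iota => /(_ hk)/hasPn/(_ l); rewrite mem_iota ij => /(_ hl).
rewrite mem_iota => hj; apply/hasPn => k; rewrite mem_iota => hk.
apply/hasPn => l; rewrite mem_iota => hl.
by case: eqP => //= /eqP ij; apply: h.
Qed.

Definition max_move : nat := n.-1 * m * m.

(** Each of the other n - 1 inputs excludes at most m^2 places, and there are
    more candidates than that. *)
Lemma exists_free t i x : (i < n)%N ->
  exists2 d, (d <= max_move)%N & ~~ clash (upd t i (x + d%:Z)) i.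
Proof.
move=> hi; pose ban := [seq t u.1 + sZ`_u.2.2 - sZ`_u.2.1 - x | u <-
  [seq (j, kl) | j <- rem i (iota 0 n),
                 kl <- [seq (k, l) | k <- iota 0 m, l <- iota 0 m]]].
have size_ban : size ban = max_move.
  rewrite size_map !size_allpairs !size_iota size_rem ?mem_iota //.
  by rewrite size_iota mulnA.
have [/hasP[d]|] := boolP (has (fun d => ~~ clash (upd t i (x + d%:Z)) i)
                            (iota 0 max_move.+1)).
  by rewrite mem_iota => hd hc; exists d.
move=> /hasPn none; exfalso.
have sub : {subset [seq d%:Z | d <- iota 0 max_move.+1] <= ban}.
  move=> _ /mapP[d hd ->]; have /negPn/hasP[j hj] := none d hd.
  case/hasP=> k hk /hasP[l hl] /andP[ij]; rewrite /upd eqxx [j == i]eq_sym (negPf ij).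
  move=> /eqP e; apply/mapP; exists (j, (k, l)); last by rewrite /= -e; ring.
  apply: allpairs_f; last exact: allpairs_f.
  by rewrite (mem_rem_uniq _ (iota_uniq _ _)) !inE eq_sym ij.
suff /uniq_leq_size/(_ sub) : uniq [seq d%:Z | d <- iota 0 max_move.+1].
  by rewrite size_map size_iota size_ban ltnn.
by rewrite map_inj_uniq ?iota_uniq // => a b [].
Qed.

Definition moved_vars : seq nat := [:: flag; jX; kZ; lZ; dist].

Lemma relocate_sem s t i : ready s -> vars s cap = max_move%:Z ->
  (i < n)%N -> vars s iX = i%:Z -> tabs s t -> t i = sX`_i ->
  exists2 a, sX`_i <= a <= sX`_i + max_move%:Z /\ ~~ clash (upd t i a) i
    & keeps moved_vars s (sem relocate s) /\
      tabs (sem relocate s) (upd t i a).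
Proof.
move=> hs hcap hi ei hT ti.
(* Until a free place is found, round d starts at distance d with all smaller
   distances excluded. *)
pose Inv d s' := keeps moved_vars s s' /\ exists a,
  [/\ tabs s' (upd t i a), sX`_i <= a <= sX`_i + d%:Z
    & ~~ clash (upd t i a) i \/ (a = sX`_i + d%:Z /\ forall e, (e < d)%N ->
        clash (upd t i (sX`_i + e%:Z)) i)].
have hN : trips (vars s cap) = max_move by rewrite hcap trips_nat.
rewrite /relocate; set body := Seq _ _.
have [|d s1 hd [kp [a [hT1 ha hc]]]|s1 -> [kp [a [hT1 ha hc]]]] :=
  @sem_for_inv Inv dist cap body s _ hN.
- split; first exact: keeps_refl.
  exists (sX`_i); split; [|by lia|by right; split=> //; lia].
  by move=> j hj; rewrite /upd hT //; case: eqP => // ->.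
- set s2 := set_var dist d%:Z s1.
  have kp2 : keeps moved_vars s s2.
    exact: keeps_set_var_trans.
  have hs2 : ready s2 by apply: ready_keeps kp2 _ hs.
  have ei2 : vars s2 iX = i%:Z by rewrite -ei; case: kp2 => ->.
  have [ag hf] := detect_sem s2 scoped_clash.
  rewrite (any_clash hs2 hi ei2 hT1) in hf.
  rewrite /body sem_seq sem_if; move: (sem (detect _) s2) ag hf => s3 ag hf.
  have kp3 : keeps moved_vars s s3.
    apply: keeps_trans kp2 _; last first.
      by apply: agree_keeps ag => v; apply: id.
    by move=> v; rewrite !inE => /or4P[] ->; rewrite ?orbT.
  have eT : arrs s3 = arrs s1 by case: ag => _ <-.
  rewrite [holds _ _]/= hf; case: (boolP (clash _ i)) => hcl; last first.
    rewrite ltxx; split=> //; exists a; split; [|by lia|by left].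
    by move=> j hj; rewrite eT hT1.
  rewrite ltr01.
  case: hc => [hc|[ea hc]]; first by rewrite hcl in hc.
  split; first exact: keeps_set_arr_trans.
  exists (sX`_i + d.+1%:Z); split; [|by lia|right; split=> // e].
      move=> j hj /=; rewrite eT hT1 //.
      have -> : vars s3 iX = i%:Z by rewrite -ei; case: kp3 => ->.
      have -> : vars s3 dist = d%:Z by case: ag => <-.
      have [_ /(_ _ hi)[-> _ _] _] := ready_keeps kp isT hs.
      by rewrite /upd eqz_nat -addn1 PoszD; case: eqP.
  by rewrite ltnS leq_eqVlt => /orP[/eqP ->|/hc//]; rewrite -ea.
have kp' : keeps moved_vars s (set_var dist max_move%:Z s1).
  exact: keeps_set_var_trans.
exists a => //; split=> //; case: hc => // -[ea hc].
have [e he hfree] := exists_free t sX`_i hi.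
move: he; rewrite leq_eqVlt => /orP[/eqP e_eq|/hc]; last by rewrite (negPf hfree).
by rewrite ea -e_eq.
Qed.

(** The invariant of the loop over the inputs: the first i are settled. A
    settled bad input is clear of all others, including those that are still
    to be moved. *)
Definition placed (i : nat) (t : nat -> int) : Prop :=
  [/\ forall j, (i <= j < n)%N -> t j = sX`_j,
      forall j, (j < i)%N -> ~~ bad sX`_j -> t j = sX`_j
    & forall j, (j < i)%N -> bad sX`_j ->
        sX`_j <= t j <= sX`_j + max_move%:Z /\ ~~ clash t j].

(** The place found for x_i is clear of the inputs moved before, so these
    remain clear as well: clashing is symmetric. *)
Lemma placed_upd i t a : (i < n)%N -> bad sX`_i -> placed i t ->
  sX`_i <= a <= sX`_i + max_move%:Z -> ~~ clash (upd t i a) i ->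
  placed i.+1 (upd t i a).
Proof.
move=> hi hb [h1 h2 h3] ha hc; split=> j.
- case/andP=> ij hj; rewrite /upd gtn_eqF // h1 //; lia.
- rewrite ltnS leq_eqVlt /upd => /orP[/eqP ->|ji]; first by rewrite hb.
  by rewrite ltn_eqF //; apply: h2.
rewrite ltnS leq_eqVlt => /orP[/eqP -> _|ji hbj]; first by rewrite {1 2}/upd eqxx.
have [hj hcj] := h3 j ji hbj; rewrite {1 2}/upd (ltn_eqF ji); split=> //.
apply/clashPn => j' k l hj' hk hl jj'; have [e|ne] := eqVneq j' i.
  subst j'; rewrite eq_sym; apply: (clashPn _ _ hc) => //; last by rewrite eq_sym.
  exact: ltn_trans ji hi.
rewrite /upd (ltn_eqF ji) (negPf ne); exact: (clashPn _ _ hcj).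
Qed.

Lemma place_sem s t : ready s -> vars s cap = max_move%:Z -> tabs s t ->
  (forall j, (j < n)%N -> t j = sX`_j) ->
  keeps (iX :: moved_vars) s (sem place s) /\
  exists2 t', tabs (sem place s) t' & placed n t'.
Proof.
move=> hs hcap hT ht.
pose Inv i s' := keeps (iX :: moved_vars) s s' /\
  exists2 t', tabs s' t' & placed i t'.
have hN : trips (vars s nX) = n by case: hs => -[-> _ _ _] _ _; rewrite trips_nat.
rewrite /place; set body := Seq _ _.
have [|i s1 hi [kp [t1 hT1 hp]]|s1 -> [kp [t1 hT1 hp]]] :=
  @sem_for_inv Inv iX nX body s _ hN; last first.
- split; last by exists t1.
  exact: keeps_set_var_trans.
- set s2 := set_var iX i%:Z s1.
  have kp2 : keeps (iX :: moved_vars) s s2.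
    exact: keeps_set_var_trans.
  have hs2 : ready s2 by apply: ready_keeps kp2 _ hs.
  have [ag hf] := detect_sem s2 scoped_bad.
  rewrite (any_bad hs2 hi erefl) in hf.
  rewrite /body sem_seq sem_if; move: (sem (detect _) s2) ag hf => s3 ag hf.
  have kp3 : keeps (iX :: moved_vars) s s3.
    apply: keeps_trans kp2 _; last first.
      by apply: agree_keeps ag => v; apply: id.
    by move=> v; rewrite !inE => /or4P[] ->; rewrite ?orbT.
  have hT3 : tabs s3 t1 by move=> j hj; case: ag => _ <- _ _; apply: hT1.
  rewrite [holds _ _]/= hf; case: (boolP (bad _)) => hb; last first.
    rewrite ltxx; split=> //; exists t1 => //.
    case: hp => h1 h2 h3; split=> j.
    + by case/andP=> ij hj; apply: h1; rewrite hj (ltnW ij).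
    + rewrite ltnS leq_eqVlt => /orP[/eqP -> _|]; last exact: h2.
      by apply: h1; rewrite leqnn.
    + by rewrite ltnS leq_eqVlt => /orP[/eqP ->|]; [rewrite (negPf hb)|exact: h3].
  have hs3 : ready s3 by apply: ready_keeps kp3 _ hs.
  have ei3 : vars s3 iX = i%:Z by case: ag => <-.
  have hcap3 : vars s3 cap = max_move%:Z by case: kp3 => ->.
  have ti : t1 i = sX`_i by case: hp => -> //; rewrite leqnn.
  have [a [ha hc] [kp4 hT4]] := relocate_sem hs3 hcap3 hi ei3 hT3 ti.
  split; last by exists (upd t1 i a) => //; apply: placed_upd.
  by apply: keeps_trans kp3 kp4 => v; rewrite !inE => ->; rewrite orbT.
- split; first exact: keeps_refl.
  by exists t => //; split=> // j; rewrite ltn0.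
Qed.

(** * Writing the tables *)

Lemma contest_sem s t i k : ready s ->
  (i < n)%N -> vars s iX = i%:Z -> (k < m)%N -> vars s kZ = k%:Z -> tabs s t ->
  agree [:: flag; jX; lZ] s (sem contest s) /\
  vars (sem contest s) flag = if beaten t i k then 1 else 0.
Proof.
move=> hs hi ei hk ek hT; rewrite /contest !sem_seq.
have ag0 : agree [:: flag; jX; lZ] s (sem (Asg flag (Num 0)) s).
  by apply: agree_set_var_r; apply: mem_head.
have [ag1 f1] := mark_sem (sem (Asg flag (Num 0)) s) scoped_heavier.
have ag1' := agree_trans ag0 ag1.
have [ag2 f2] := mark_sem
  (sem (mark flag pairs heavier) (sem (Asg flag (Num 0)) s)) scoped_tie.
split; first exact: agree_trans ag1' ag2.
rewrite f2 f1 -(any_agree scoped_tie ag1') -(any_agree scoped_heavier ag0).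
rewrite -(any_contest hs hi ei hk ek hT) orbC.
by case: (any pairs tie s).
Qed.

Definition winners_row (t : nat -> int) (i k : nat) : seq (nat * nat) :=
  [seq (i, k') | k' <- iota 0 k & ~~ beaten t i k'].

Definition winners (t : nat -> int) (i : nat) : seq (nat * nat) :=
  flatten [seq winners_row t i' m | i' <- iota 0 i].

Lemma winners_rowS t i k : winners_row t i k.+1 =
  winners_row t i k ++ (if beaten t i k then [::] else [:: (i, k)]).
Proof.
rewrite /winners_row -addn1 iotaD filter_cat map_cat /= add0n.
by case: (beaten t i k).
Qed.

Lemma winnersS t i : winners t i.+1 = winners t i ++ winners_row t i m.
Proof.
by rewrite /winners -addn1 iotaD map_cat flatten_cat /= cats0 add0n.
Qed.

Lemma size_winners t i k :
  (size (winners t i ++ winners_row t i k) <= i * m + k)%N.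
Proof.
have row_le i' k' : (size (winners_row t i' k') <= k')%N.
  by rewrite size_map -{2}(size_iota 0 k') size_filter count_size.
rewrite size_cat leq_add //; elim: i => // i IHi.
by rewrite winnersS size_cat mulSn addnC leq_add.
Qed.

Definition scratch : seq nat := [:: iX; kZ; flag; jX; lZ].

(** Both passes over the winners are inductions over the list of those found so
    far; the command c may not disturb the loops. *)
Lemma for_winners_sem (P : seq (nat * nat) -> state -> Prop) t c s :
  (forall u s', P u s' -> ready s' /\ tabs s' t) ->
  (forall u s1 s2, agree scratch s1 s2 -> P u s1 -> P u s2) ->
  iX \notin assigned c -> kZ \notin assigned c ->
  (forall i k s', (i < n)%N -> (k < m)%N ->
     vars s' iX = i%:Z -> vars s' kZ = k%:Z -> ~~ beaten t i k ->
     P (winners t i ++ winners_row t i k) s' ->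
     P (winners t i ++ winners_row t i k ++ [:: (i, k)]) (sem c s')) ->
  P [::] s -> P (winners t n) (sem (for_winners c) s).
Proof.
move=> hP hag hci hck hstep h0; rewrite /for_winners.
set body := Seq contest _; set inner := For kZ nZ _.
have ag_i a s' : agree scratch s' (set_var iX a s').
  exact: agree_set_var_r.
have ag_k a s' : agree scratch s' (set_var kZ a s').
  exact: agree_set_var_r.
have hn : trips (vars s nX) = n.
  by have [[[-> _ _ _] _ _] _] := hP _ _ h0; rewrite trips_nat.
have [|i s1 hi h1|s' -> h] :=
  @sem_for_inv (fun i => P (winners t i)) iX nX inner s n hn; last first.
- exact: hag h.
- pose Inv k s' := vars s' iX = i%:Z /\ P (winners t i ++ winners_row t i k) s'.
  have h1' := hag _ _ _ (ag_i i%:Z s1) h1.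
  have hm : trips (vars (set_var iX i%:Z s1) nZ) = m.
    by have [[[_ -> _ _] _ _] _] := hP _ _ h1'; rewrite trips_nat.
  have [|k s2 hk [ei h2]|s2 -> [ei h2]] :=
    @sem_for_inv Inv kZ nZ body _ m hm; last first.
  + by rewrite winnersS; apply: hag h2.
  + have h2' := hag _ _ _ (ag_k k%:Z s2) h2.
    set s3 := set_var kZ k%:Z s2 in h2' *.
    have [hs3 hT3] := hP _ _ h2'.
    have ei3 : vars s3 iX = i%:Z by [].
    have ek3 : vars s3 kZ = k%:Z by [].
    have [ag hf] := contest_sem hs3 hi ei3 hk ek3 hT3.
    rewrite /body sem_seq sem_if.
    move: (sem contest s3) ag hf => s4 ag hf.
    have ei4 : vars s4 iX = i%:Z by case: ag => <-.
    have ek4 : vars s4 kZ = k%:Z by case: ag => <-.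
    have h4 : P (winners t i ++ winners_row t i k) s4.
      by apply: hag h2'; apply: agree_sub ag => v; rewrite !inE => ->; rewrite !orbT.
    rewrite [holds _ _]/= hf /Inv winners_rowS.
    case: (boolP (beaten t i k)) => hb /=; first by rewrite cats0.
    rewrite sem_frame //; split=> //; exact: hstep.
  + by split; rewrite // /winners_row /= cats0.
- exact: h0.
Qed.

Definition table_entry (t : nat -> int) (u : nat * nat) : seq int :=
  [:: t u.1 + sZ`_u.2; - t u.1].

Lemma for_count_sem t s : ready s -> tabs s t -> vars s cnt = 0 ->
  let s' := sem (for_winners count_one) s in
  [/\ ready s', tabs s' t, vars s' cnt = (size (winners t n))%:Z
    & sout s' = sout s].
Proof.
move=> hs hT hc.
pose P (u : seq (nat * nat)) s' := [/\ ready s', tabs s' t,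
  vars s' cnt = (size u)%:Z & sout s' = sout s].
apply: (@for_winners_sem P t) => //.
- by move=> u s' [].
- move=> u s1 s2 ag [h1 h2 h3 h4]; case: (ag) => hv ha hi ho.
  split; [exact: ready_agree ag _ h1 | by rewrite /tabs -ha | |].
    by rewrite -hv.
  by rewrite -ho.
- move=> i k s' hi hk ei ek _ [h1 h2 h3 h4].
  have [[e1 e2 _ _] _ _] := h1.
  rewrite /count_one sem_if /= e1 e2 h3 ifT; last first.
    have := size_winners t i k; rewrite subr_gt0 -PoszM ltz_nat; nia.
  by split=> //=; rewrite catA [in RHS]size_cat PoszD.
Qed.

Lemma for_emit_sem t s : ready s -> tabs s t ->
  sout (sem (for_winners emit_one) s) =
  sout s ++ flatten [seq table_entry t u | u <- winners t n].
Proof.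
move=> hs hT.
pose P (u : seq (nat * nat)) s' := [/\ ready s', tabs s' t
  & sout s' = sout s ++ flatten [seq table_entry t v | v <- u]].
suff [] : P (winners t n) (sem (for_winners emit_one) s) by [].
apply: (@for_winners_sem P t) => //.
- by move=> u s' [].
- move=> u s1 s2 ag [h1 h2 h3]; case: (ag) => hv ha hi ho.
  split; [exact: ready_agree ag _ h1 | by rewrite /tabs -ha |].
  by rewrite -ho.
- move=> i k s' hi hk ei ek _ [h1 h2 h3].
  have [_ _ /(_ _ hk)[z1 _ _]] := h1.
  split=> //=; rewrite ei ek h2 // z1 h3 !map_cat !flatten_cat /=.
  by rewrite /table_entry /= sub0r -!cats1 -!catA.
- by split=> //=; rewrite cats0.
Qed.

Lemma emit_T_sem t s : ready s -> tabs s t ->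
  let s' := sem (For iX nX (Output (cell aX iX) ;; Output (cell aT iX))) s in
  [/\ ready s', tabs s' t &
    sout s' = sout s ++ flatten [seq [:: sX`_i; t i] | i <- iota 0 n]].
Proof.
move=> hs hT.
pose Inv i s' := [/\ ready s', tabs s' t &
  sout s' = sout s ++ flatten [seq [:: sX`_j; t j] | j <- iota 0 i]].
have hn : trips (vars s nX) = n by case: hs => -[-> _ _ _] _ _; rewrite trips_nat.
have [|i s1 hi [h1 h2 h3]|s1 -> [h1 h2 h3]] := @sem_for_inv Inv iX nX
  (Output (cell aX iX) ;; Output (cell aT iX)) s n hn; last first.
- by split.
- have [_ /(_ _ hi)[x1 _ _] _] := h1.
  split=> //; rewrite -[i.+1]addn1 iotaD map_cat flatten_cat /= x1 h2 // h3.
  by rewrite -!cats1 -!catA.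
- by split=> //=; rewrite cats0.
Qed.

Lemma init_T_sem s : ready s ->
  let s' := sem init_T s in
  [/\ ready s', tabs s' (fun i => sX`_i), sinp s' = sinp s, sout s' = sout s
    & vars s' cap = vars s cap].
Proof.
move=> hs.
pose Inv i s' := [/\ ready s', forall j, (j < i)%N -> arrs s' aT j%:Z = sX`_j,
  sinp s' = sinp s, sout s' = sout s & vars s' cap = vars s cap].
have hn : trips (vars s nX) = n by case: hs => -[-> _ _ _] _ _; rewrite trips_nat.
have [|i s1 hi [h1 h2 h3 h4 h5]|s1 -> [h1 h2 h3 h4 h5]] := @sem_for_inv Inv iX nX
  (Store aT (Var iX) (cell aX iX)) s n hn; last first.
- by split.
- have [_ /(_ _ hi)[x1 _ _] _] := h1.
  split=> // j; rewrite ltnS leq_eqVlt /= eqz_nat x1.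
  by case: eqP => [->|_ /h2].
- by split.
Qed.

Lemma algorithm_sem s0 : (0 < n)%N -> sout s0 = [::] ->
  sinp s0 = (n%:Z :: rows sX p) ++ (m%:Z :: rows sZ q) ++ enc_rat K ->
  let s1 := sem (Input nX) s0 in
  let s2 := sem (read_table aX iX nX) s1 in
  let s3 := sem (Input nZ) s2 in
  let s4 := sem (read_table aZ kZ nZ ;; main) s3 in
  [/\ vars s1 nX = n%:Z, vars s3 nZ = m%:Z & exists2 t, placed n t
    & sout s4 = enc_table [seq (sX`_i, t i) | i <- iota 0 n] ++
        enc_table [seq (t u.1 + sZ`_u.2, - t u.1) | u <- winners t n]].
Proof.
move=> n_gt0 ho0 hi0 s1 s2 s3 s4.
have n1 : vars s1 nX = n%:Z by rewrite /= hi0.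
have i1 : sinp s1 = rows sX p ++ (m%:Z :: rows sZ q) ++ enc_rat K.
  by rewrite /= hi0.
have [ld2 i2 o2 v2 _] := @read_table_sem aX iX nX sX p _ s1 isT isT isT n1 i1.
rewrite -/s2 in ld2 i2 o2 v2; clearbody s2.
have m3 : vars s3 nZ = m%:Z by rewrite /s3 /= i2.
split=> //.
have i3 : sinp s3 = rows sZ q ++ enc_rat K by rewrite /s3 /= i2.
have o3 : sout s3 = [::] by rewrite /s3 /= o2.
have n3 : vars s3 nX = n%:Z by rewrite /s3 /= v2.
have ld3 : loaded s3 aX sX p by [].
rewrite /s4; clearbody s3; clear s4.
have [ld4 i4 o4 v4 a4] := @read_table_sem aZ kZ nZ sZ q _ s3 isT isT isT m3 i3.
rewrite /main !sem_seq.
move: (sem (read_table aZ kZ nZ) s3) ld4 i4 o4 v4 a4 => s5 ld5 i5 o5 v5 a5.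
set s6 := sem (Asg cap _) _.
have r6 : ready s6.
  split; last exact: ld5.
    by rewrite /s6 /= i5 !v5 // n3 m3.
  by rewrite /loaded /s6 /= !a5.
have c6 : vars s6 cap = max_move%:Z.
  rewrite /s6 /= !v5 // n3 m3 /max_move; move: n_gt0.
  by case: (size sX) => // N _; rewrite /= !PoszM; congr (_ * _ * _); lia.
have o6 : sout s6 = [::] by rewrite /s6 /= o5.
clearbody s6.
have [r7 T7 _ o7 c7] := init_T_sem r6.
move: (sem init_T s6) r7 T7 o7 c7 => s7 r7 T7 o7 c7; rewrite c6 in c7.
have [kp8 [t T8 pt]] := place_sem r7 c7 T7 (fun _ _ => erefl).
have r8 := ready_keeps kp8 isT r7.
have o8 : sout (sem place s7) = [::] by case: kp8 => _ _ _ ->; rewrite o7.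
move: (sem place s7) T8 r8 o8 => s8 T8 r8 o8.
exists t => //.
have o9 : sout (sem (Output (Var nX)) s8) = [:: n%:Z].
  by case: r8 => -[/= -> _ _ _] _ _; rewrite o8.
have [r10 T10 o10] :=
  @emit_T_sem t (sem (Output (Var nX)) s8) r8 T8.
rewrite o9 in o10.
move: (sem (For _ _ _) _) r10 T10 o10 => s10 r10 T10 o10.
have [r11 T11 c11 o11] :=
  @for_count_sem t (sem (Asg cnt (Num 0)) s10) r10 T10 erefl.
move: (sem (for_winners count_one) _) r11 T11 c11 o11 => s11 r11 T11 c11 o11.
rewrite (@for_emit_sem t (sem (Output (Var cnt)) s11) r11 T11) /=.
rewrite o11 c11 /= o10 /enc_table !size_map size_iota -!map_comp /=.
by rewrite cat_rcons.
Qed.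

End Run.

(** * Running time *)

Lemma bitlen_bound (a : int) : (`|a| <= 2 ^ bitlen a)%N.
Proof. by rewrite /bitlen ltnW // trunc_log_ltn. Qed.

Lemma bitlen_le_bitsize (a : int) w : a \in w -> (bitlen a <= bitsize w)%N.
Proof. by move=> h; rewrite /bitsize (big_rem a h) /= leq_addr. Qed.

Lemma size_le_bitsize w : (size w <= bitsize w)%N.
Proof. by rewrite -sum1_size /bitsize leq_sum. Qed.

Lemma size_rows l f : size (rows l f) = (3 * size l)%N.
Proof.
by rewrite /rows; elim: l => //= x l ->; rewrite mulnS.
Qed.

Lemma bounded_change gamma gamma' alpha S s :
  bounded gamma alpha S s ->
  (forall v, gamma' v = gamma v \/ (`|vars s v| <= bound S (gamma' v))%N) ->
  bounded gamma' alpha S s.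
Proof. by case=> hv ha hi h; split=> // v; case: (h v) => // ->. Qed.

(** The degrees may change during the run: the length of a list is just a
    number of the input for the command that reads it, and is then known to be
    small enough to bound loops. *)
Lemma staged_run g0 g1 g2 alpha E S (a b c d : cmd) s0 cfg :
  (16 <= S)%N -> (0 < E)%N ->
  typed g0 alpha E a -> typed g1 alpha E b ->
  typed g1 alpha E c -> typed g2 alpha E d ->
  let s1 := sem a s0 in let s3 := sem c (sem b s1) in
  bounded g0 alpha S s0 -> bounded g1 alpha S s1 -> bounded g2 alpha S s3 ->
  represents s0 cfg -> pc cfg = 0%N ->
  exists2 time, (time <= (step_bound g0 S a + (step_bound g1 S b +
      (step_bound g1 S c + step_bound g2 S d))) * unit_cost E S)%N
    & runs (compile 0 (a ;; b ;; c ;; d)) cfg time (sout (sem d s3)).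
Proof.
move=> S_ge16 E_gt0 ta tb tc td s1 s3 b0 b1 b3 rep0 e0.
set P := compile 0 _.
have at_all : code_at P 0 (compile 0 (a ;; b ;; c ;; d)) by [].
have [at0 /code_at_seq[at1 /code_at_seq[at2 at3]]] := code_at_seq at_all.
have b2 := bounded_sem S_ge16 tb b1.
have [c1 r1 [rep1 e1]] := compile_correct S_ge16 E_gt0 ta at0 b0 rep0 e0.
have [c2 r2 [rep2 e2]] := compile_correct S_ge16 E_gt0 tb at1 b1 rep1 e1.
have [c3 r3 [rep3 e3]] := compile_correct S_ge16 E_gt0 tc at2 b2 rep2 e2.
have [c4 r4 [rep4 e4]] := compile_correct S_ge16 E_gt0 td at3 b3 rep3 e3.
have [|time htime hrun] :=
  reach_runs (reach_trans r1 (reach_trans r2 (reach_trans r3 r4))).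
  by rewrite e4 size_compile /= !addnA.
by exists time => //; rewrite -(rep_out rep4).
Qed.

Definition input_of (sX sZ : seq int) (p q : int -> rat) (K : rat) : seq int :=
  ((size sX)%:Z :: rows sX p) ++ ((size sZ)%:Z :: rows sZ q) ++ enc_rat K.

Lemma machine_correct : exists bd : {poly nat},
  forall sX sZ p q K, (0 < size sX)%N ->
  let w := input_of sX sZ p q K in
  exists time o t, [/\ runs machine (init w) time o, (time <= bd.[bitsize w])%N,
    placed sX sZ p q K (size sX) t
  & o = enc_table [seq (sX`_i, t i) | i <- iota 0 (size sX)] ++
        enc_table [seq (t u.1 + sZ`_u.2, - t u.1)
                  | u <- winners sX sZ p q t (size sX)]].
Proof.
pose g0 := var_degree large large; pose g1 := var_degree small large.
pose g2 := var_degree small small.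
pose steps x := (step_bound g0 (x + 16) (Input nX) +
  (step_bound g1 (x + 16) (read_table aX iX nX) +
  (step_bound g1 (x + 16) (Input nZ) +
   step_bound g2 (x + 16) (read_table aZ kZ nZ ;; main))))%N.
have [bd hbd] : polynomial (fun x => steps x * (8 * ((x + 16) * 40 + 1)))%N.
  do ![exact: step_bound_polynomial | exact: polynomial_const
      | exact: polynomial_shift | apply: polynomial_add
      | apply: polynomial_mul].
exists bd => sX sZ p q K n_gt0 w.
set S := (bitsize w + 16)%N.
have S_ge16 : (16 <= S)%N by rewrite leq_addl.
have le_w : (size sX + size sZ <= bitsize w)%N.
  apply: leq_trans (size_le_bitsize w).
  rewrite /w /input_of !size_cat /= !size_rows; lia.
pose s0 := State (fun=> 0) (fun _ _ => 0) w [::].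
have b0 : bounded g0 arr_degree S s0.
  split=> //; apply/allP => a ha; apply: leq_trans (bitlen_bound a) _.
  rewrite /bound /= mul1n muln1 leq_exp2l //.
  exact: leq_trans (bitlen_le_bitsize ha) (leq_addr _ _).
have rep0 : represents s0 (init w) by [].
have [] := @algorithm_sem sX sZ p q K s0 n_gt0 erefl erefl.
set s1 := sem (Input nX) s0; set s2 := sem _ s1; set s3 := sem _ s2.
set s4 := sem _ s3 => n1 m3 [t ht ho].
have E0 : (0 < 40)%N by [].
have b1 : bounded g1 arr_degree S s1.
  apply: bounded_change (bounded_sem S_ge16 typed_read_nX b0) _.
  case=> [|v]; last by left.
  by right; rewrite n1 /bound /= expn1 muln0 muln1 /S; lia.
have b2 := bounded_sem S_ge16 typed_read_X b1.
have b3 : bounded g2 arr_degree S s3.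
  apply: bounded_change (bounded_sem S_ge16 typed_read_nZ b2) _.
  case=> [|[|v]]; [by left | | by left].
  by right; rewrite m3 /bound /= expn1 muln0 muln1 /S; lia.
have [time htime hrun] := staged_run S_ge16 E0 typed_read_nX typed_read_X
  typed_read_nZ typed_rest b0 b1 b3 rep0 erefl.
exists time, (sout s4), t; split=> //.
by rewrite -hbd; move: htime; rewrite /unit_cost /width -[(S * 40).+1]addn1.
Qed.

(** * The approximation ratio *)

Section Ratio.

Variables (sX sZ : seq int) (p q : int -> rat) (K : rat).
Hypotheses (uniq_sX : uniq sX) (uniq_sZ : uniq sZ).
Hypotheses (p_ge0 : forall x, 0 <= p x) (q_ge0 : forall z, 0 <= q z).
Hypotheses (sum_q : \sum_(z <- sZ) q z = 1) (K_gt0 : 0 < K).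

Local Notation n := (size sX).
Local Notation m := (size sZ).
Local Notation bad := (bad sX sZ p q K).

Definition loss (T delta : int -> int) (x z : int) : rat :=
  p x * q z *
  ((T x - x)%:~R ^+ 2 + K * (T x + delta (T x + z))%:~R ^+ 2).

Definition total (T delta : int -> int) : rat :=
  \sum_(x <- sX) \sum_(z <- sZ) loss T delta x z.

Lemma sqr_int_ge1 (a : int) : a != 0 -> 1 <= a%:~R ^+ 2 :> rat.
Proof.
move=> a0; rewrite expr2 -intrM -[1]/((1 : int)%:~R) ler_int.
by move/eqP: a0; nia.
Qed.

Section Competitor.

Variables T delta : int -> int.

Lemma loss_ge0 x z : 0 <= loss T delta x z.
Proof.
have K_ge0 := ltW K_gt0; rewrite /loss mulr_ge0 ?(mulr_ge0 (p_ge0 x)) //.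
by rewrite addr_ge0 ?sqr_ge0 // mulr_ge0 ?sqr_ge0.
Qed.

Lemma sum_loss_ge0 x : 0 <= \sum_(z <- sZ) loss T delta x z.
Proof. by apply: sumr_ge0 => z _; apply: loss_ge0. Qed.

Lemma total_ge0 : 0 <= total T delta.
Proof. by apply: sumr_ge0 => x _; apply: sum_loss_ge0. Qed.

Lemma move_cost x : x \in sX -> T x != x -> p x <= total T delta.
Proof.
move=> hx hT; rewrite /total (big_rem x hx) /=.
apply: ler_wpDr; first by apply: sumr_ge0 => y _; apply: sum_loss_ge0.
rewrite -[leLHS]mulr1 -sum_q mulr_sumr; apply: ler_sum => z _.
rewrite /loss -[leLHS]mulr1 ler_wpM2l ?mulr_ge0 //.
apply: ler_wpDr; first by rewrite mulr_ge0 ?sqr_ge0 // ltW.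
by apply: sqr_int_ge1; rewrite subr_eq0.
Qed.

(** With errors a and b at the common observation, a - b = x - x' and
    2 (a^2 + b^2) = (a - b)^2 + (a + b)^2. *)
Lemma pair_cost x x' z z' mu :
  x \in sX -> x' \in sX -> z \in sZ -> z' \in sZ -> x != x' ->
  x + z = x' + z' -> T x = x -> T x' = x' ->
  0 <= mu -> mu <= p x * q z -> mu <= p x' * q z' ->
  K * mu * (x - x')%:~R ^+ 2 <= 2 * total T delta.
Proof.
move=> hx hx' hz hz' xx' e ex ex' mu_ge0 h h'.
have two : loss T delta x z + loss T delta x' z' <= total T delta.
  rewrite /total (big_rem x hx) /=; apply: lerD.
    rewrite (big_rem z hz) /= lerDl; apply: sumr_ge0 => y _; exact: loss_ge0.
  have hx'' : x' \in rem x sX.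
    by rewrite (mem_rem_uniq _ uniq_sX) !inE eq_sym xx'.
  rewrite (big_rem x' hx'') /= (big_rem z' hz') /= -addrA lerDl addr_ge0 //.
    by apply: sumr_ge0 => y _; exact: loss_ge0.
  by apply: sumr_ge0 => y _; exact: sum_loss_ge0.
have one (y t : int) : mu <= p y * q t -> T y = y ->
    mu * (K * (y + delta (y + t))%:~R ^+ 2) <= loss T delta y t.
  move=> hmu ey; rewrite /loss ey subrr expr0n /= add0r.
  by rewrite ler_wpM2r // mulr_ge0 ?sqr_ge0 // ltW.
have := one _ _ h ex; have := one _ _ h' ex'; rewrite -e.
set d := delta _ => l1 l2.
apply: le_trans (_ : 2 * (mu * (K * (x + d)%:~R ^+ 2) +
                          mu * (K * (x' + d)%:~R ^+ 2)) <= _); last first.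
  by rewrite ler_pM2l // addrC; apply: le_trans (lerD l1 l2) _; rewrite addrC.
have -> : (x - x')%:~R = (x + d)%:~R - (x' + d)%:~R :> rat.
  by rewrite -intrB; congr (_%:~R); ring.
move: (_%:~R) (_%:~R) => a b.
have muK : 0 <= mu * K by rewrite mulr_ge0 // ltW.
rewrite -subr_ge0.
have -> : 2 * (mu * (K * b ^+ 2) + mu * (K * a ^+ 2)) - K * mu * (b - a) ^+ 2 =
  mu * K * (a + b) ^+ 2 by ring.
by rewrite mulr_ge0 ?sqr_ge0.
Qed.

(** Either x or the more probable x' is moved, at a price of at least p x, or
    both are kept and confusing them costs more than p x. *)
Lemma bad_cost x : x \in sX -> bad x -> p x <= total T delta.
Proof.
move=> hx /hasP[x' hx' /hasP[z hz /hasP[z' hz' /and4P[/eqP e hp hq hq']]]].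
have [ex|] := eqVneq (T x) x; last exact: move_cost.
have [ex'|hT'] := eqVneq (T x') x'; last first.
  exact: le_trans hp (move_cost hx' hT').
have xx' : x != x'.
  by apply: contraTneq hq => ->; rewrite subrr expr0n mulr0 -leNgt.
have [le|lt] := leP (p x * q z) (p x' * q z').
  have := pair_cost hx hx' hz hz' xx' e ex ex'
    (mulr_ge0 (p_ge0 x) (q_ge0 z)) (lexx _) le.
  move: hq; have := p_ge0 x; move: (total T delta) (_ ^+ 2) => V D.
  set c := K * q z * D => px_ge0 hc.
  have -> : K * (p x * q z) * D = p x * c by rewrite /c; ring.
  by nra.
have := pair_cost hx hx' hz hz' xx' e ex ex'
  (mulr_ge0 (p_ge0 x') (q_ge0 z')) (ltW lt) (lexx _).
lra.
Qed.

(** If the competitor keeps both inputs, it pays for confusing them. If it moves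
    one, it pays at least the smaller of p x and p x', and this bounds the loss
    because the less probable input is not bad. *)
Lemma kept_cost x x' z z' mu :
  x \in sX -> x' \in sX -> z \in sZ -> z' \in sZ -> x + z = x' + z' ->
  ~~ bad x -> ~~ bad x' ->
  0 <= mu -> mu <= p x * q z -> mu <= p x' * q z' ->
  K * mu * (x - x')%:~R ^+ 2 <= 2 * total T delta.
Proof.
wlog le_p : x x' z z' / p x <= p x'.
  move=> H hx hx' hz hz' e hb hb' hmu h h'.
  have [le|/ltW le] := leP (p x) (p x'); first exact: (H x x' z z').
  have -> : (x - x')%:~R ^+ 2 = (x' - x)%:~R ^+ 2 :> rat.
    by rewrite -[x - x']opprB rmorphN /= sqrrN.
  by apply: (H x' x z' z).
move=> hx hx' hz hz' e hb _ mu_ge0 h h'.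
have V_ge0 := total_ge0.
have [<-|xx'] := eqVneq x x'.
  by rewrite subrr expr0n mulr0 mulr_ge0.
have cheap : K * mu * (x - x')%:~R ^+ 2 <= 2 * p x.
  have /hasPn/(_ _ hx')/hasPn/(_ _ hz)/hasPn/(_ _ hz') := hb.
  rewrite /costly e eqxx le_p /= negb_and -!leNgt.
  have : 0 <= (x - x')%:~R ^+ 2 :> rat by rewrite sqr_ge0.
  move: (_ ^+ 2) => D D_ge0; have KD : 0 <= K * D by rewrite mulr_ge0 // ltW.
  case/orP=> hc.
    apply: le_trans (_ : p x * (K * q z * D) <= _); last first.
      by rewrite mulrC ler_wpM2r.
    have -> : p x * (K * q z * D) = p x * q z * (K * D) by ring.
    have -> : K * mu * D = mu * (K * D) by ring.
    by rewrite ler_wpM2r.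
  apply: le_trans hc.
  have -> : K * (p x' * q z') * D = p x' * q z' * (K * D) by ring.
  have -> : K * mu * D = mu * (K * D) by ring.
  by rewrite ler_wpM2r.
have [ex|hT] := eqVneq (T x) x; last first.
  by apply: le_trans cheap _; rewrite ler_pM2l // move_cost.
have [ex'|hT'] := eqVneq (T x') x'; last first.
  apply: le_trans cheap _; rewrite ler_pM2l //.
  exact: le_trans le_p (move_cost hx' hT').
exact: (pair_cost hx hx' hz hz' xx' e ex ex' mu_ge0 h h').
Qed.

End Competitor.

(** Per input x, moving costs at most ((n - 1) m^2)^2 V and the m observations
    at most 2 (m - 1) V each, the factor m - 1 expressing that nothing is ever
    confused when m = 1; and (n - 1)^2 m^4 + 2 m (m - 1) <= n^2 m^4. *)
Lemma approximation (T delta T' delta' : int -> int) : (0 < n)%N ->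
  (forall x, x \in sX -> ~~ bad x -> T x = x) ->
  (forall x, x \in sX -> bad x -> x <= T x <= x + (max_move sX sZ)%:Z) ->
  (forall x x' z z', x \in sX -> x' \in sX -> z \in sZ -> z' \in sZ ->
    bad x -> x != x' -> T x + z != T x' + z') ->
  (forall x z, x \in sX -> z \in sZ -> exists x0 z0,
    [/\ x0 \in sX, z0 \in sZ, T x0 + z0 = T x + z,
        p x * q z <= p x0 * q z0 & delta (T x + z) = - T x0]) ->
  total T delta <= (n ^ 3 * m ^ 4)%N%:R * total T' delta'.
Proof.
move=> n_gt0 hkeep hmove hclear hdelta.
set V := total T' delta'; have V_ge0 : 0 <= V := total_ge0 _ _.
have move_le x : x \in sX ->
    p x * (T x - x)%:~R ^+ 2 <= (max_move sX sZ ^ 2)%N%:R * V.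
  move=> hx; have [hb|hb] := boolP (bad x); last first.
    by rewrite hkeep // subrr expr0n mulr0 mulr_ge0.
  rewrite mulrC ler_pM ?sqr_ge0 //; last exact: bad_cost.
  have /andP[h1 h2] := hmove x hx hb.
  rewrite natrX -[_%:R]/((max_move sX sZ)%:Z%:~R) lerXn2r ?nnegrE ?ler0z ?ler_int //.
    by rewrite subr_ge0.
  by rewrite lerBlDl.
have error_le x z : x \in sX -> z \in sZ ->
    p x * q z * (K * (T x + delta (T x + z))%:~R ^+ 2) <=
    (2 * m.-1)%N%:R * V.
  move=> hx hz; have [x0 [z0 [hx0 hz0 e hw ->]]] := hdelta x z hx hz.
  have [->|xx0] := eqVneq x x0.
    by rewrite subrr expr0n !mulr0 mulr_ge0.
  have hb : ~~ bad x.
    apply/negP => hb; have := hclear _ _ _ _ hx hx0 hz hz0 hb xx0.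
    by rewrite e eqxx.
  have hb0 : ~~ bad x0.
    apply/negP => hb0.
    have := hclear _ _ _ _ hx0 hx hz0 hz hb0; rewrite eq_sym xx0 e eqxx.
    by move/(_ isT).
  have hT := hkeep _ hx hb; have hT0 := hkeep _ hx0 hb0.
  rewrite hT hT0 in e *.
  have m_gt1 : (1 < m)%N.
    rewrite ltnNge; apply/negP => m_le1; case/eqP: xx0.
    have ez : z0 = z.
      by move: hz hz0 m_le1; case: (sZ) => [|a [|]] //; rewrite !inE => /eqP-> /eqP->.
    by apply: (addIr z); rewrite -e ez.
  apply: le_trans (_ : 2 * V <= _); last first.
    by rewrite ler_wpM2r // ler_nat leq_pmulr // -ltnS prednK // ltnW.
  have w_ge0 : 0 <= p x * q z by rewrite mulr_ge0.
  rewrite mulrA [_ * K]mulrC.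
  exact: kept_cost hx hx0 hz hz0 (esym e) hb hb0 w_ge0 (lexx _) hw.
have per_x x : x \in sX -> \sum_(z <- sZ) loss T delta x z <=
    (max_move sX sZ ^ 2 + m * (2 * m.-1))%N%:R * V.
  move=> hx; under eq_bigr => z _ do rewrite /loss mulrDr.
  rewrite big_split /= natrD mulrDl; apply: lerD.
    have -> : \sum_(z <- sZ) p x * q z * (T x - x)%:~R ^+ 2 =
        p x * (T x - x)%:~R ^+ 2.
      rewrite -[RHS]mulr1 -sum_q mulr_sumr; apply: eq_bigr => z _; ring.
    exact: move_le.
  rewrite big_seq; apply: le_trans (ler_sum _ (fun z hz => error_le x z hx hz)) _.
  rewrite -big_seq big_const_seq count_predT iter_addr_0.
  by rewrite -mulrnAl -mulrnA mulnC.
rewrite /total big_seq; apply: le_trans (ler_sum _ per_x) _.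
rewrite -big_seq big_const_seq count_predT iter_addr_0 -mulrnAl -mulrnA.
rewrite ler_wpM2r // ler_nat [leqLHS]mulnC (expnS n 2).
rewrite -[leqRHS]mulnA leq_mul2l; apply/orP; right.
rewrite /max_move; move: n_gt0; move: n m => [//|N] M _ /=.
case: M => [|M] /=; first by rewrite muln0.
have -> : ((N * M.+1 * M.+1) ^ 2 = N ^ 2 * M.+1 ^ 4)%N by ring.
have -> : (N.+1 ^ 2 * M.+1 ^ 4 = N ^ 2 * M.+1 ^ 4 + (2 * N + 1) * M.+1 ^ 4)%N.
  by ring.
rewrite leq_add2l; apply: leq_trans (leq_pmull _ _); last by rewrite addn1.
rewrite !expnS expn0 muln1; nia.
Qed.

End Ratio.

(** * The policy described by the tables *)

Lemma ex_maximal (A : eqType) (r : rel A) (s : seq A) x :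
  irreflexive r -> transitive r -> x \in s ->
  exists y, [/\ y \in s, y = x \/ r x y & ~~ has (r y) s].
Proof.
move=> irr tr; have [N] := ubnP (count (r x) s).
elim: N x => // N IHN x hN hx; have [/hasP[y hy xy]|hmax] := boolP (has (r x) s).
  have [|z [hz hyz hmax]] := IHN y _ hy.
    rewrite -ltnS; apply: leq_trans hN; rewrite !(permP (perm_to_rem hy)) /= irr xy add0n.
    by rewrite ltnS; apply: sub_count => z; apply: tr.
  exists z; split=> //; right; case: hyz => [->//|]; exact: tr.
by exists x; split=> //; left.
Qed.

Section Policy.

Variables (sX sZ : seq int) (p q : int -> rat) (K : rat) (t : nat -> int).
Hypotheses (uniq_sX : uniq sX) (uniq_sZ : uniq sZ).
Hypothesis placed_t : placed sX sZ p q K (size sX) t.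

Local Notation n := (size sX).
Local Notation m := (size sZ).
Local Notation bad := (bad sX sZ p q K).
Local Notation winner_list := (winners sX sZ p q t n).
Local Notation beaten := (beaten sX sZ p q t).

Definition pair_beats (u v : nat * nat) : bool :=
  beats sX sZ p q t u.1 u.2 v.1 v.2.

Definition all_pairs : seq (nat * nat) :=
  [seq (i, k) | i <- iota 0 n, k <- iota 0 m].

Lemma mem_iota0 N i : (i \in iota 0 N) = (i < N)%N.
Proof. by rewrite mem_iota. Qed.

Lemma mem_all_pairs i k : ((i, k) \in all_pairs) = (i < n)%N && (k < m)%N.
Proof.
apply/allpairsP/andP => [[[i' k'] []]|[hi hk]].
  by rewrite !mem_iota0 /= => hi hk [-> ->].
by exists (i, k); rewrite !mem_iota0.
Qed.

Lemma beaten_has u : beaten u.1 u.2 = has (pair_beats u) all_pairs.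
Proof.
apply/hasP/hasP => [[j hj /hasP[l hl h]]|[[j l]]].
  exists (j, l) => //; move: hj hl.
  by rewrite mem_all_pairs !mem_iota0 => -> ->.
rewrite mem_all_pairs => /andP[hj hl] h; exists j; rewrite ?mem_iota0 //.
by apply/hasP; exists l; rewrite ?mem_iota0.
Qed.

Lemma mem_winners u : (u \in winner_list) = (u \in all_pairs) && ~~ beaten u.1 u.2.
Proof.
case: u => i k; rewrite mem_all_pairs.
apply/flattenP/andP => /= [[s /mapP[i' hi' ->]]|[/andP[hi hk] hb]].
  case/mapP=> k'; rewrite mem_filter !mem_iota0 in hi' * => /andP[hb hk] [-> ->].
  by rewrite hi' hk.
exists (winners_row sX sZ p q t i m); first by apply: map_f; rewrite mem_iota0.
by apply: map_f; rewrite mem_filter hb mem_iota0.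
Qed.

Lemma uniq_winners : uniq winner_list.
Proof.
suff -> : winner_list = [seq u <- all_pairs | ~~ beaten u.1 u.2].
  by rewrite filter_uniq // allpairs_uniq ?iota_uniq // => -[a b] [c d] _ _.
rewrite /winners /all_pairs filter_flatten -map_comp.
by congr flatten; apply: eq_map => i; rewrite /= filter_map.
Qed.

Lemma pair_beats_irr : irreflexive pair_beats.
Proof. by move=> u; rewrite /pair_beats /beats /outweighs !ltxx !andbF. Qed.

Lemma pair_beats_trans : transitive pair_beats.
Proof.
move=> v u w; rewrite /pair_beats /beats /outweighs => /andP[/eqP e1 h1].
case/andP=> /eqP e2 h2; rewrite e2 e1 eqxx /=.
case/orP: h1 h2 => [h1|/andP[/eqP <- h1]] /orP[h2|/andP[/eqP e h2]].
- by rewrite (lt_trans h1 h2).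
- by rewrite e h1.
- by rewrite h2.
- by rewrite e eqxx (lt_trans h2 h1) orbT.
Qed.

Lemma unbeaten i k j l : ~~ pair_beats (i, k) (j, l) ->
  t j + sZ`_l = t i + sZ`_k ->
  p sX`_j * q sZ`_l <= p sX`_i * q sZ`_k /\
  (p sX`_j * q sZ`_l = p sX`_i * q sZ`_k -> sZ`_k <= sZ`_l).
Proof.
rewrite /pair_beats /beats => h e; rewrite e eqxx in h.
move: h; rewrite negb_or -leNgt negb_and => /andP[h1 h2]; split=> // ew.
by move: h2; rewrite ew eqxx -leNgt.
Qed.

(** A moved input shares no observation with any other, so in particular not
    its place; here m > 0 matters. *)
Lemma table_inj i j : (0 < m)%N -> (i < n)%N -> (j < n)%N -> t i = t j -> i = j.
Proof.
move=> m_gt0 hi hj e; apply/eqP/negPn/negP => ij.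
case: placed_t => _ hkeep hmove.
have [hb|hb] := boolP (bad sX`_i).
  have [_ /clashPn/(_ j 0 0 hj m_gt0 m_gt0 ij)] := hmove i hi hb.
  by rewrite e eqxx.
have [hb'|hb'] := boolP (bad sX`_j).
  rewrite eq_sym in ij.
  have [_ /clashPn/(_ i 0 0 hi m_gt0 m_gt0 ij)] := hmove j hj hb'.
  by rewrite e eqxx.
rewrite !hkeep // in e.
by move/eqP: e; rewrite nth_uniq // (negPf ij).
Qed.

Definition est_table : seq (int * int) :=
  [seq (t u.1 + sZ`_u.2, - t u.1) | u <- winner_list].

(** Two unbeaten pairs with the same observation do not beat each other, hence
    have equal weights and equal z, hence equal T x, and T is injective. *)
Lemma uniq_est_table : uniq (unzip1 est_table).
Proof.
rewrite /unzip1 -map_comp map_inj_in_uniq ?uniq_winners // => u v.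
rewrite !mem_winners => /andP[hu hbu] /andP[hv hbv] /= e.
rewrite beaten_has in hbu; rewrite beaten_has in hbv.
case: u v hu hbu hv hbv e => [i k] [j l] hu /hasPn hbu hv /hasPn hbv /= e.
have [h1 h2] := unbeaten (hbu _ hv) (esym e).
have [h3 h4] := unbeaten (hbv _ hu) e.
have ew := le_anti (introT andP (conj h1 h3)).
move: hu hv; rewrite !mem_all_pairs => /andP[hi hk] /andP[hj hl].
have ekl : k = l.
  apply/eqP; rewrite -(nth_uniq 0 hk hl uniq_sZ).
  by apply/eqP/le_anti; rewrite (h2 ew) (h4 (esym ew)).
subst l; move/addIr: e => /table_inj -> //.
exact: leq_ltn_trans hk.
Qed.

Definition policy_T (x : int) : int := t (index x sX).

Definition policy_delta (y : int) : int :=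
  nth 0 (unzip2 est_table) (index y (unzip1 est_table)).

Lemma policy_T_nth i : (i < n)%N -> policy_T sX`_i = t i.
Proof. by move=> hi; rewrite /policy_T index_uniq. Qed.

Lemma policy_deltaE e : e \in est_table -> policy_delta e.1 = e.2.
Proof.
move=> he; rewrite /policy_delta; set k := index e est_table.
have hk : (k < size est_table)%N by rewrite index_mem.
have e1 : (unzip1 est_table)`_k = e.1 by rewrite (nth_map e) // nth_index.
have e2 : (unzip2 est_table)`_k = e.2 by rewrite (nth_map e) // nth_index.
by rewrite -e1 index_uniq ?uniq_est_table ?e2 // size_map.
Qed.

Lemma ex_winner i k : (i < n)%N -> (k < m)%N -> exists j l,
  [/\ (j < n)%N, (l < m)%N, (t j + sZ`_l, - t j) \in est_table,
      t j + sZ`_l = t i + sZ`_k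
    & p sX`_i * q sZ`_k <= p sX`_j * q sZ`_l].
Proof.
move=> hi hk; have hik : (i, k) \in all_pairs by rewrite mem_all_pairs hi.
have [[j l] [hjl hor hmax]] := ex_maximal pair_beats_irr pair_beats_trans hik.
move: (hjl); rewrite mem_all_pairs => /andP[hj hl].
exists j, l; split=> //.
- by apply/mapP; exists (j, l) => //; rewrite mem_winners hjl beaten_has.
- by case: hor => [[-> ->]|/andP[/eqP]].
- case: hor => [[-> ->]//|/andP[_]] /=.
  by case/orP=> [/ltW//|/andP[/eqP -> _]].
Qed.

Lemma policy_good (T' delta' : int -> int) :
  (forall x, 0 <= p x) -> (forall z, 0 <= q z) -> \sum_(z <- sZ) q z = 1 ->
  0 < K -> (0 < n)%N ->
  total sX sZ p q K policy_T policy_delta <=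
  (n ^ 3 * m ^ 4)%N%:R * total sX sZ p q K T' delta'.
Proof.
move=> p_ge0 q_ge0 sum_q K_gt0 n_gt0.
have idx x : x \in sX -> (index x sX < n)%N by rewrite index_mem.
case: placed_t => _ hkeep hmove.
apply: approximation => //.
- by move=> x hx hb; rewrite /policy_T hkeep ?nth_index ?idx.
- move=> x hx hb.
  by have := hmove _ (idx x hx); rewrite nth_index // => /(_ hb)[].
- move=> x x' z z' hx hx' hz hz' hb xx'.
  have := hmove _ (idx x hx); rewrite nth_index // => /(_ hb)[_ /clashPn].
  move/(_ (index x' sX) (index z sZ) (index z' sZ)).
  rewrite !nth_index // !index_mem; apply=> //.
  by apply: contra xx' => /eqP e; rewrite -(nth_index 0 hx) e nth_index.
- move=> x z hx hz.
  have hz' : (index z sZ < m)%N by rewrite index_mem.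
  have [j [l [hj hl hin e hw]]] := ex_winner (idx x hx) hz'.
  rewrite !nth_index // in e hw.
  exists sX`_j, sZ`_l; rewrite !mem_nth // policy_T_nth //; split=> //.
  by rewrite /policy_T -e (policy_deltaE hin).
Qed.

Lemma policy_est_keys : unzip1 est_table =i
  [seq policy_T x + z | x <- sX, z <- sZ].
Proof.
move=> y; apply/mapP/allpairsP => [[e /mapP[[i k]]]|[[x z] [hx hz ->]]].
  rewrite mem_winners mem_all_pairs => /andP[/andP[hi hk] _] -> ->.
  by exists (sX`_i, sZ`_k); rewrite /= !mem_nth // policy_T_nth.
have hi : (index x sX < n)%N by rewrite index_mem.
have hk : (index z sZ < m)%N by rewrite index_mem.
have [j [l [hj hl hin e hw]]] := ex_winner hi hk.
by exists (t j + sZ`_l, - t j) => //=; rewrite e nth_index.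
Qed.

End Policy.

Lemma Phi_total (K : rat) (pX pZ : massfun) (sX sZ : seq int) T delta :
  perm_eq sX (finsupp pX) -> perm_eq sZ (finsupp pZ) ->
  Phi K pX pZ T delta = total sX sZ pX pZ K T delta.
Proof.
move=> hX hZ; rewrite /Phi /expect_indep /total -(perm_big _ hX).
by apply: eq_bigr => x _; rewrite -(perm_big _ hZ).
Qed.

Theorem theorem3 :
  exists (P : program) (q : {poly nat}),
    forall (I : instance) (w : seq int), valid I -> describes w I ->
    exists (t : nat) (o : seq int) (T delta : int -> int),
      [/\ runs P (init w) t o,
          (t <= q.[bitsize w])%N,
          returns o I T delta
        & Phi (Kcost I) (pX0 I) (pZ I) T delta
          <= (#|` finsupp (pX0 I)| ^ 3 * #|` finsupp (pZ I)| ^ 4)%N%:R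
             * Phi_star (Kcost I) (pX0 I) (pZ I)].
Proof.
have [bd hbd] := machine_correct.
exists machine, bd => -[pX pZ K] w [/= hX hZ K_gt0] [sX [sZ [/= pmX pmZ ->]]].
have uX : uniq sX by rewrite (perm_uniq pmX) fset_uniq.
have uZ : uniq sZ by rewrite (perm_uniq pmZ) fset_uniq.
have n_gt0 : (0 < size sX)%N.
  case: hX => _; rewrite -(perm_big _ pmX); case: (sX) => //.
  by rewrite big_nil => /esym/eqP; rewrite oner_eq0.
have sum_q : \sum_(z <- sZ) pZ z = 1.
  by case: hZ => _ <-; apply: perm_big.
have [time [o [t [hrun htime pt ho]]]] := hbd sX sZ pX pZ K n_gt0.
pose T := policy_T sX t; pose delta := policy_delta sX sZ pX pZ t.
exists time, o, T, delta; split=> //.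
- exists [seq (sX`_i, t i) | i <- iota 0 (size sX)], (est_table sX sZ pX pZ t).
  split=> //; split.
  + rewrite /unzip1 -map_comp (_ : map _ _ = sX) //.
    exact: (mkseq_nth 0 sX).
  + move=> e /mapP[i]; rewrite mem_iota0 => hi -> /=.
    exact: policy_T_nth.
  + apply: uniq_perm; rewrite ?fset_uniq ?(uniq_est_table uX uZ pt) // => y.
    rewrite policy_est_keys //; apply/allpairsP/imfset2P => /=.
      case=> -[x z] /= [hx hz ->]; exists x; first by rewrite -(perm_mem pmX).
      by exists z; first by rewrite -(perm_mem pmZ).
    case=> x hx [z hz ->]; exists (x, z) => /=.
    by rewrite (perm_mem pmX) (perm_mem pmZ).
  + exact: (policy_deltaE uX uZ pt).
have [[T' [delta' <-]] _] := Phi_starP hX hZ K_gt0.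
rewrite !(Phi_total _ _ _ pmX pmZ) -(perm_size pmX) -(perm_size pmZ).
apply: policy_good => //; [by case: hX | by case: hZ].
Qed.
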